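(* Let $p$ be an odd prime, let $L/K$ be a separable field extension of degree $p^2$, let $\widetilde{L}/K$ be its normal closure and $G\simeq \mathrm{Gal}(\widetilde{L}/K)$. The extension $L/K$ has a Hopf Galois structure of cyclic type (i.e. of type $C_{p^2}$) if and only if $G$ is isomorphic to the semidirect product $C_{p^2}\rtimes C_m$, for $m$ a divisor of $p(p-1)$. In that case, the number of Hopf Galois structures of cyclic type on $L/K$ is $p$ for $m=1$ and $m=p$, and is equal to $1$ in the remaining cases.
   Context: A Hopf Galois structure on a finite field extension $L/K$ is a pair $(H,\mu)$, where $H$ is a finite cocommutative $K$-Hopf algebra and $\mu: H\to \operatorname{End}_K(L)$ is a $K$-linear map giving $L$ a left $H$-module algebra structure and inducing a $K$-vector space isomorphism $L\otimes_K H\to \operatorname{End}_K(L)$. Hopf Galois structures are counted up to isomorphism (a $K$-Hopf algebra isomorphism compatible with the actions). Let $L/K$ be separable of degree $g$, $\widetilde{L}$ its Galois closure, $G=\mathrm{Gal}(\widetilde{L}/K)$, $G'=\mathrm{Gal}(\widetilde{L}/L)$, and let $\lambda:G\hookrightarrow S_g=\mathrm{Sym}(G/G')$ be given by the action of $G$ on the left cosets $G/G'$. By the Greither–Pareigis theorem, Hopf Galois structures on $L/K$ are in bijection with regular subgroups $N$ of $S_g$ normalized by $\lambda(G)$; the Hopf algebra corresponding to $N$ is $\widetilde{L}[N]^G$, where $G$ acts on $\widetilde{L}$ by $K$-automorphisms and on $N$ by conjugation through $\lambda$. The type of a Hopf Galois structure is the isomorphism class of the corresponding group $N$. $C_n$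 denotes the cyclic group of order $n$. The semidirect product $C_{p^2}\rtimes C_m$ is the one with faithful action, i.e. $C_m$ is the unique subgroup of order $m$ of the cyclic group $\mathrm{Aut}(C_{p^2})\simeq(\mathbf{Z}/p^2\mathbf{Z})^*$ of order $p(p-1)$, so that $C_{p^2}\rtimes C_m$ is a subgroup of the holomorph $\mathrm{Hol}(C_{p^2})=C_{p^2}\rtimes \mathrm{Aut}(C_{p^2})$. *)

(* Defs.v *)
From HB Require Import structures.
From mathcomp Require Import all_boot all_order all_algebra.
From mathcomp Require Import all_fingroup all_solvable all_field.

Set Implicit Arguments.
Unset Strict Implicit.
Unset Printing Implicit Defensive.

Import GroupScope GRing.Theory.
Local Open Scope ring_scope.

(* The tensor product of finite dimensional spaces, modelled by matrices of
   coordinates: u (x) v is the outer product of the coordinates of u and v in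
   the library's bases of U and V.  [tlift f] is the linear map on the tensor
   product induced by a bilinear f (lemma [tlift_tens]), so that, for a
   comultiplication comul, [tlift f (comul h)] is the Sweedler sum
   \sum_(h) f h_(1) h_(2). *)
Definition tensor (K : fieldType) (U V : vectType K) : vectType K :=
  'M[K]_(\dim {:U}, \dim {:V}).

Definition tens (K : fieldType) (U V : vectType K) (u : U) (v : V) :
    tensor U V :=
  \matrix_(i, j) (coord (vbasis {:U}) i u * coord (vbasis {:V}) j v).

Definition tlift (K : fieldType) (U V : vectType K) (W : lmodType K)
    (f : U -> V -> W) (t : tensor U V) : W :=
  \sum_i \sum_j (t : 'M[K]_(\dim {:U}, \dim {:V})) i j *:
    f (vbasis {:U})`_i (vbasis {:V})`_j.

Lemma tlift_tens (K : fieldType) (U V : vectType K) (W : lmodType K)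
    (f : U -> V -> W) (u : U) (v : V) :
    (forall y, linear (f^~ y)) -> (forall x, linear (f x)) ->
  tlift f (tens u v) = f u v.
Proof.
move=> fl fr.
have fl0 y : f 0 y = 0.
  by have := fl y (-1) 0 0; rewrite scaler0 add0r scaleN1r addNr.
have fr0 x : f x 0 = 0.
  by have := fr x (-1) 0 0; rewrite scaler0 add0r scaleN1r addNr.
have suml n (a : 'I_n -> K) (x : 'I_n -> U) y :
    f (\sum_i a i *: x i) y = \sum_i a i *: f (x i) y.
  elim/big_rec2: _ => [|i z t _ <-]; first exact: fl0.
  exact: (fl y (a i) (x i) t).
have sumr n (a : 'I_n -> K) (y : 'I_n -> V) x :
    f x (\sum_i a i *: y i) = \sum_i a i *: f x (y i).
  elim/big_rec2: _ => [|i z t _ <-]; first exact: fr0.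
  exact: (fr x (a i) (y i) t).
rewrite [u in RHS](coord_vbasis (memvf u)) suml; apply: eq_bigr => i _.
rewrite [v in RHS](coord_vbasis (memvf v)) sumr scaler_sumr.
by apply: eq_bigr => j _; rewrite scalerA mxE.
Qed.

Definition tmul (K : fieldType) (A : falgType K) (s t : tensor A A) :
    tensor A A :=
  tlift (fun a b => tlift (fun c d => tens (a * c) (b * d)) t) s.

Record cocommHopf (K : fieldType) := CocommHopf {
  hopf_alg :> falgType K;
  comul : {linear hopf_alg -> tensor hopf_alg hopf_alg};
  counit : {linear hopf_alg -> K^o};
  antipode : {linear hopf_alg -> hopf_alg};
  comul1 : comul 1 = tens 1 1;
  comulM : forall x y, comul (x * y) = tmul (comul x) (comul y);
  counit1 : counit 1 = 1;
  counitM : forall x y, counit (x * y) = counit x * counit y;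
  (* both sides in H (x) (H (x) H) *)
  comulA : forall h,
    tlift (fun a b => tlift (fun a1 a2 => tens a1 (tens a2 b)) (comul a))
      (comul h)
    = tlift (fun a b => tens a (comul b)) (comul h);
  counitl : forall h, tlift (fun a b => (counit a : K) *: b) (comul h) = h;
  counitr : forall h, tlift (fun a b => (counit b : K) *: a) (comul h) = h;
  antipodel : forall h,
    tlift (fun a b => antipode a * b) (comul h) = (counit h : K)%:A;
  antipoder : forall h,
    tlift (fun a b => a * antipode b) (comul h) = (counit h : K)%:A;
  comulC : forall h, tlift (fun a b => tens b a) (comul h) = comul h
}.

Arguments comul [K] _.
Arguments counit [K] _.
Arguments antipode [K] _.

Record hopfGalois (K : fieldType) (L : fieldExtType K) := HopfGalois {
  hg_hopf :> cocommHopf K;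
  hg_act : {linear hg_hopf -> 'End(L)};
  hg_act1 : forall x, hg_act 1 x = x;
  hg_actM : forall h k x, hg_act (h * k) x = hg_act h (hg_act k x);
  hg_act_one : forall h, hg_act h 1 = (counit hg_hopf h : K)%:A;
  hg_act_mul : forall h x y,
    hg_act h (x * y) = tlift (fun a b => hg_act a x * hg_act b y) (comul hg_hopf h);
  (* x (x) h is sent to the endomorphism y |-> x * (h y) *)
  hg_bij : bijective
    (tlift (fun (x : L) (h : hg_hopf) => (amull x \o hg_act h)%VF))
}.

Arguments hg_act [K L] _.

Definition hg_iso (K : fieldType) (L : fieldExtType K) (A B : hopfGalois L) :
    Prop :=
  exists f : {lrmorphism A -> B},
    [/\ bijective f,
        forall h, comul B (f h)
          = tlift (fun a b => tens (f a) (f b)) (comul A h),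
        forall h, counit B (f h) = counit A h,
        forall h, antipode B (f h) = f (antipode A h) &
        forall h, hg_act B (f h) = hg_act A h].

Definition hg_number (K : fieldType) (L : fieldExtType K)
    (P : hopfGalois L -> Prop) (k : nat) : Prop :=
  exists F : 'I_k -> hopfGalois L,
    [/\ forall i, P (F i),
        forall i j, hg_iso (F i) (F j) -> i = j &
        forall A, P A -> exists i, hg_iso A (F i)].

(* Lt is normal over K, being a splitting field; it is the normal closure of
   L over K when no proper intermediate field containing L is normal. *)
Definition is_normal_closure (K : fieldType) (Lt : splittingFieldType K)
    (L : {subfield Lt}) : Prop :=
  forall M : {subfield Lt},
    (L <= M)%VS -> normalField 1 M -> (M : {vspace Lt}) = {:Lt}%VS.

(* Products in gal_of and in {perm T} compose from left to right:
   (s * t) x = t (s x).  The left cosets sG' for ordinary composition are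
   therefore the right cosets G' :* s here, and the left translation
   tG' |-> stG' is the right translation by s. *)
Definition gal_cosets (K : fieldType) (Lt : splittingFieldType K)
    (L : {subfield Lt}) : {set {set gal_of {:Lt}}} :=
  rcosets 'Gal({:Lt} / L) 'Gal({:Lt} / 1).

Definition gal_lambda (K : fieldType) (Lt : splittingFieldType K)
    (L : {subfield Lt}) (s : gal_of {:Lt}) : {perm {set gal_of {:Lt}}} :=
  restr_perm (gal_cosets L) (actperm 'Rs s).

Definition regular_on (T : finType) (S : {set T}) (N : {group {perm T}}) :=
  [/\ N \subset perm.Sym S, [transitive N, on S | 'P] &
      {in S, forall x, 'C_N[x | 'P] = 1%g}].

Definition normalized_by_gal (K : fieldType) (Lt : splittingFieldType K)
    (L : {subfield Lt}) (N : {group {perm {set gal_of {:Lt}}}}) : Prop :=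
  gal_lambda L @: 'Gal({:Lt} / 1) \subset 'N(N).

(* An element \sum_(n in N) c_n n of the group algebra Lt[N] is represented by
   its coefficient function c, extended by 0 outside of N.  Multiplication in
   Lt[N] uses ordinary composition in N, which is n' * n for n o n'. *)
Definition in_grpalg (T : finGroupType) (F : fieldType) (N : {group T})
    (c : {ffun T -> F}) : Prop :=
  forall n, n \notin N -> c n = 0.

Definition grpalg_mul (T : finGroupType) (F : fieldType) (N : {group T})
    (c d : {ffun T -> F}) : {ffun T -> F} :=
  [ffun m => \sum_(n in N) \sum_(n' in N | (n' * n)%g == m) c n * d n'].

(* s (\sum c_n n) = \sum s(c_n) (lambda(s) o n o lambda(s)^-1). *)
Definition gal_fixed (K : fieldType) (Lt : splittingFieldType K)
    (L : {subfield Lt}) (N : {group {perm {set gal_of {:Lt}}}})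
    (c : {ffun {perm {set gal_of {:Lt}}} -> Lt}) : Prop :=
  forall s n, s \in 'Gal({:Lt} / 1) -> n \in N ->
    c (n ^ gal_lambda L s)%g = s (c n).

(* A is isomorphic to the Hopf Galois structure attached to N by Greither and
   Pareigis.  The map phi identifies the Hopf algebra of A with Lt[N]^G: its
   Hopf operations are those of Lt[N] (the n in N are group-like), Lt[N] (x) Lt[N]
   over Lt being read as functions on N x N.  Lt[N]^G acts on L by
     (\sum c_n n) x = \sum c_n (n^-1(G'))(x),
   where the coset n^-1(G') acts on L through any of its representatives. *)
Definition gp_corresponds (K : fieldType) (Lt : splittingFieldType K)
    (L : {subfield Lt}) (A : hopfGalois (subvs_of L))
    (N : {group {perm {set gal_of {:Lt}}}}) : Prop :=
  exists phi : {linear A -> {ffun {perm {set gal_of {:Lt}}} -> Lt}},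
  [/\ injective phi
      /\ (forall c, (exists h, phi h = c) <->
                    in_grpalg N c /\ gal_fixed L N c),
      phi 1 = [ffun n => (n == 1%g)%:R]
      /\ (forall h k, phi (h * k) = grpalg_mul N (phi h) (phi k)),
      (forall h n n', tlift (fun a b => phi a n * phi b n') (comul A h)
                      = if n == n' then phi h n else 0)
      /\ (forall h, (counit A h : K)%:A = \sum_(n in N) phi h n :> Lt),
      forall h n, phi (antipode A h) n = phi h (n^-1)%g &
      forall h (x : subvs_of L),
        vsval (hg_act A h x) =
        \sum_(n in N)
          phi h n * repr ((n^-1)%g ('Gal({:Lt} / L) : {set _})) (vsval x)].

Definition hg_has_type (K : fieldType) (Lt : splittingFieldType K)
    (L : {subfield Lt}) (gT : finGroupType) (T : {group gT})
    (A : hopfGalois (subvs_of L)) : Prop :=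
  exists N : {group {perm {set gal_of {:Lt}}}},
    [/\ regular_on (gal_cosets L) N, normalized_by_gal L N,
        gp_corresponds A N & N \isog T].

Definition hol (gT : finGroupType) (C : {group gT}) : finGroupType :=
  sdprod_groupType [Aut C]%gact.

Definition hol_sdprod (gT : finGroupType) (C : {group gT})
    (M : {group {perm gT}}) : {group hol C} :=
  (sdpair1 [Aut C]%gact @* C <*> sdpair2 [Aut C]%gact @* M)%G.

(* G is isomorphic to the semidirect product of C_n by the subgroup of order m
   of Aut(C_n); for n = p^2 with p an odd prime, Aut(C_n) is cyclic, so that
   this subgroup is unique. *)
Definition isog_cyclic_sdprod (gT : finGroupType) (G : {group gT})
    (n m : nat) : Prop :=
  exists M : {group {perm 'Z_n}},
    [/\ M \subset Aut (Zp n), #|M| = m &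
        G \isog hol_sdprod (Zp_group n) M].

(* Main.v *)
Require Import Defs.
From HB Require Import structures.
From mathcomp Require Import all_boot all_order all_algebra.
From mathcomp Require Import all_fingroup all_solvable all_field.
From mathcomp Require Import zify.

(** By Greither and Pareigis, a Hopf Galois structure of cyclic type on L/K is
    a regular cyclic subgroup N, normalized by the Galois group, of the group
    of permutations of the p^2 cosets. Two independent arguments are needed:
    finite group theory counts these subgroups, and Galois descent relates
    them to Hopf Galois structures up to isomorphism.

    Group theory. Let N = <n> be regular and cyclic of degree p^2. Identify
    the points with Z/p^2 so that n is x |-> x + 1. A permutation d fixing the
    base point 0 with d^-1 n d = n^(1+pk) is then multiplication by 1+pk, and
    c = d n is the affine map x |-> (1+pk)x + 1. As p is odd, c^p = n^p, so that
    c again generates a regular cyclic group ([twist_regular]), and <n> and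
    <c> normalize each other ([twist_conj]). Every transitive group normalizing
    N contains such a c, by Sylow's theorem. Either it contains d, hence N
    itself, or <c> is normal in it: in both cases it has a normal regular
    cyclic subgroup ([regular_cyclic_normal]), and is a semidirect product
    C_(p^2) : C_m with C_m the stabilizer of a point
    ([regular_normal_cyclic_sdprod]). Conversely, in such a semidirect product
    C_(p^2) meets the point stabilizers trivially because the action on cosets
    is faithful ([normal_cyclic_regular]). For the count, fix the normal
    regular subgroup C = <c>. The regular cyclic subgroups normalized by C are
    the p groups <e^k c>, where e is multiplication by 1+p; a multiplication by
    b in the point stabilizer normalizes <e^k c> exactly when p divides k(b-1).
    Either every b is 1 mod p, that is m = 1 or m = p, and all p groups
    qualify, or only C does ([count_regular_cyclic]).

    Descent. Let M be the Galois closure and G its group. Given N, the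
    K-algebra H = M[N]^G of G-fixed elements contains enough orbit sums to span
    M[N] over M ([orbit_span]), while K-independent fixed elements stay
    M-independent ([fixed_Lt_free]). Consequently an element of H (x) H is
    determined by its values on N x N ([tlift_eval_inj]). The comultiplication
    is placing the values of h on the diagonal ([ev_dcomul]), and all the Hopf
    axioms become identities between functions on N. Dedekind's independence of the embeddings of L, which are
    indexed by N, makes L (x) H -> End(L) injective, hence bijective by
    dimension ([dact_bij]). Finally, a structure recovers N: its action on L
    gives the coefficient functions, by Dedekind again, and the product of H
    then gives the group law of N and its action on the cosets
    ([gp_group_unique]). *)

Set Implicit Arguments.
Unset Strict Implicit.
Unset Printing Implicit Defensive.

Local Open Scope nat_scope.

(** * Arithmetic modulo the square of an odd prime *)

Lemma expn_1p p k j : (1 + p * k) ^ j = 1 + j * (p * k) %[mod p ^ 2].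
Proof.
elim: j => [|j IHj]; first by rewrite mul0n addn0.
rewrite expnS -modnMmr IHj modnMmr.
have -> : (1 + p * k) * (1 + j * (p * k)) =
          j * k * k * p ^ 2 + (1 + j.+1 * (p * k)).
  by rewrite -mulnn; lia.
by rewrite modnMDl.
Qed.

(** Modulo p^2 the sum is p + 'C(p, 2) p k, and p divides 'C(p, 2) because p
    is odd. *)
Lemma sum_expn_1p p k : odd p -> \sum_(j < p) (1 + p * k) ^ j = p %[mod p ^ 2].
Proof.
move=> p_odd.
have E m : \sum_(j < m) (1 + p * k) ^ j =
           m + 'C(m, 2) * (p * k) %[mod p ^ 2].
  elim: m => [|m IHm]; first by rewrite big_ord0.
  rewrite big_ord_recr /= -modnDm IHm expn_1p modnDm.
  by rewrite binS bin1 mulnDl addnACA addn1.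
rewrite E bin2odd // -!mulnA (mulnCA p.-1./2) mulnA -modnDmr.
by rewrite [p * p]/(p ^ 2) modnMr addn0.
Qed.

Lemma sum_expn_1p_modp p k b : \sum_(j < b) (1 + p * k) ^ j = b %[mod p].
Proof.
elim: b => [|b IHb]; first by rewrite big_ord0.
rewrite big_ord_recr /= -modnDm IHb -modnXm -(modnDmr 1) modnMr addn0 modnXm.
by rewrite exp1n modnDm addn1.
Qed.

Lemma expn_mod_p p a j : prime p -> a ^ (p ^ j) = a %[mod p].
Proof.
move=> pr_p; elim: j => [|j IHj]; first by rewrite expn1.
by rewrite expnSr expnM fermat_little.
Qed.

Lemma modp1_witness p a : 0 < a -> a = 1 %[mod p] -> exists k, a = 1 + p * k.
Proof.
move=> a_gt0 /eqP; rewrite eqn_mod_dvd // => /dvdnP[k Ek].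
by exists k; rewrite mulnC -Ek subnKC.
Qed.

(** * Regular cyclic groups of degree p^2 *)

Import GroupScope.
Local Open Scope group_scope.

Lemma perm_expg_fix (T : finType) (g : {perm T}) x i :
  g x = x -> (g ^+ i) x = x.
Proof.
by move=> gx; elim: i => [|i IHi]; rewrite ?perm1 // expgSr permM IHi.
Qed.

Section Sym.

Variables (T : finType) (S : {set T}).
Implicit Types (g h n m : {perm T}) (N G : {group {perm T}}).

Lemma Sym_stable g x : g \in perm.Sym S -> (g x \in S) = (x \in S).
Proof. by rewrite inE => /perm_closed->. Qed.

Lemma Sym_out g x : g \in perm.Sym S -> x \notin S -> g x = x.
Proof. by rewrite inE => /out_perm; apply. Qed.

Lemma Sym_acts G : G \subset perm.Sym S -> [acts G, on S | 'P].
Proof.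
move=> sGS; apply/subsetP=> g /(subsetP sGS) gS; rewrite !inE.
by apply/subsetP=> x; rewrite inE /= apermE Sym_stable.
Qed.

Lemma regular_card N : regular_on S N -> S != set0 -> #|N| = #|S|.
Proof.
case=> _ trN regN /set0Pn[x Sx].
rewrite -(card_orbit_stab 'P N x) regN // cards1 muln1.
by rewrite (atransP trN).
Qed.

Lemma regular_ex N x y : regular_on S N -> x \in S -> y \in S ->
  exists2 n, n \in N & n x = y.
Proof.
by case=> _ trN _ Sx Sy; have [n Nn ->] := atransP2 trN Sx Sy; exists n.
Qed.

Lemma regular_free N x n : regular_on S N -> x \in S -> n \in N -> n x = x ->
  n = 1.
Proof.
case=> _ _ regN Sx Nn nx; apply/set1P; rewrite -[[set 1]](regN x Sx).
by rewrite inE Nn; apply/astab1P.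
Qed.

Lemma regular_inj N x n m : regular_on S N -> x \in S ->
  n \in N -> m \in N -> n x = m x -> n = m.
Proof.
move=> regN Sx Nn Nm nm; apply/eqP; rewrite eq_mulgV1; apply/eqP.
by apply: (regular_free regN Sx); rewrite ?groupM ?groupV // permM nm permK.
Qed.

Lemma semiregular_regular N :
    N \subset perm.Sym S -> #|N| = #|S| -> S != set0 ->
  {in S, forall x, {in N, forall n, n x = x -> n = 1}} -> regular_on S N.
Proof.
move=> sNS cardN /set0Pn[x0 Sx0] fr.
have stab1 : {in S, forall x, 'C_N[x | 'P] = 1}.
  move=> x Sx; apply/trivgP/subsetP=> n /setIP[Nn /astab1P nx].
  by rewrite (fr x Sx n).
split=> //; apply/imsetP; exists x0 => //; apply/eqP.
rewrite eq_sym eqEcard acts_sub_orbit ?Sym_acts // Sx0 /=.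
by rewrite card_orbit stab1 //= indexg1 cardN.
Qed.

(** Such a g fixes the images of x under G, that is all of S. *)
Lemma Sym_centralizer_stab G g x : [transitive G, on S | 'P] ->
  g \in perm.Sym S -> x \in S -> g x = x -> g \in 'C(G) -> g = 1.
Proof.
move=> trG gS Sx gx /centP cgG; apply/permP=> y; rewrite perm1.
have [Sy|/(Sym_out gS)//] := boolP (y \in S).
have [h Gh ->] := atransP2 trG Sx Sy.
by rewrite /aperm -permM -cgG // permM gx.
Qed.

End Sym.

Lemma conj_fix_commute (gT : finGroupType) (n g : gT) :
  n ^ g = n -> commute g n.
Proof. by move=> ng; rewrite /commute [RHS]conjgC ng. Qed.

Lemma cent_cycle_conj (gT : finGroupType) (n g : gT) :
  n ^ g = n -> g \in 'C(<[n]>).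
Proof. by move=> ng; rewrite cent_cycle; apply/cent1P/conj_fix_commute. Qed.

(** Rigidity: an element of a point stabilizer is known from the conjugate of
    n, because two candidates differ by an element that centralizes <[n]>. *)
Lemma stab_conj_inj (T : finType) (S : {set T}) (n g h : {perm T}) x :
    regular_on S <[n]>%G -> x \in S -> g \in perm.Sym S -> h \in perm.Sym S ->
  g x = x -> h x = x -> n ^ g = n ^ h -> g = h.
Proof.
move=> [_ trN _] Sx gS hS gx hx Egh; apply/eqP; rewrite eq_mulgV1; apply/eqP.
apply: (Sym_centralizer_stab trN _ Sx).
- by rewrite groupM ?groupV.
- by rewrite permM gx -{1}hx permK.
by apply: cent_cycle_conj; rewrite conjgM Egh conjgK.
Qed.

Lemma cycle_conj_exp (gT : finGroupType) (n g : gT) : g \in 'N(<[n]>) ->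
  exists2 a, (0 < a)%N & n ^ g = n ^+ a.
Proof.
move=> nN; have : n ^ g \in <[n]> by rewrite memJ_norm ?cycle_id.
case/cycleP=> a Ea; exists (a + #[n]); first by rewrite addn_gt0 order_gt0 orbT.
by rewrite expgD expg_order mulg1.
Qed.

Lemma conj_expg_iter (gT : finGroupType) (n g : gT) a i : n ^ g = n ^+ a ->
  n ^ (g ^+ i) = n ^+ (a ^ i).
Proof.
move=> ng; elim: i => [|i IHi]; first by rewrite conjg1.
by rewrite expgSr conjgM IHi conjXg ng -expgM expnS.
Qed.

Lemma twist_expg (gT : finGroupType) (n d : gT) a i : n ^ d = n ^+ a ->
  (d * n) ^+ i = d ^+ i * n ^+ (\sum_(j < i) a ^ j).
Proof.
move=> nd; elim: i => [|i IHi]; first by rewrite big_ord0 mulg1.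
rewrite big_ord_recl expn0 expgSr IHi addnC expgD expg1 !mulgA.
congr (_ * n); rewrite -mulgA [n ^+ _ * d]conjgC mulgA -expgSr conjXg nd -expgM.
by congr (_ * n ^+ _); rewrite big_distrr; apply: eq_bigr => j _; rewrite expnS.
Qed.

Section Degree.

Variables (T : finType) (S : {set T}) (p : nat).
Hypotheses (pr_p : prime p) (p_odd : odd p) (cardS : #|S| = (p ^ 2)%N).

Let p_gt0 : (0 < p)%N. Proof. exact: prime_gt0. Qed.

Lemma degree_neq0 : S != set0.
Proof. by rewrite -cards_eq0 cardS -lt0n expn_gt0 p_gt0. Qed.

Lemma regular_order (n : {perm T}) : regular_on S <[n]>%G -> #[n] = (p ^ 2)%N.
Proof. by move/regular_card=> /(_ degree_neq0); rewrite cardS. Qed.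

Lemma expg_mod_p2 (n : {perm T}) a b : #[n] = (p ^ 2)%N ->
  (n ^+ a == n ^+ b) = (a == b %[mod p ^ 2])%N.
Proof. by move=> on; rewrite eq_expg_mod_order on. Qed.

(** If n ^ c = n ^+ a then a ^ (p ^ j) = 1 modulo p^2, and a = a ^ (p ^ j)
    modulo p by Fermat. *)
Lemma p_elt_conj_exp (n c : {perm T}) j : #[n] = (p ^ 2)%N -> c \in 'N(<[n]>) ->
  c ^+ (p ^ j) = 1 -> exists k, n ^ c = n ^+ (1 + p * k).
Proof.
move=> on /cycle_conj_exp[a a_gt0 nc] cj.
have: n ^+ (a ^ (p ^ j)) == n ^+ 1.
  by rewrite -(conj_expg_iter _ nc) cj conjg1.
rewrite expg_mod_p2 // => /eqP E.
have a1 : (a = 1 %[mod p])%N.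
  have dp : (p %| p ^ 2)%N by rewrite dvdn_mulr.
  by rewrite -(expn_mod_p a j pr_p) -(modn_dvdm _ dp) E modn_dvdm.
have [k Ek] := modp1_witness a_gt0 a1.
by exists k; rewrite nc Ek.
Qed.

(** Identify S with the integers modulo p^2 so that x0 is 0 and n is
    x |-> x + 1: then d is multiplication by 1 + p k, and d * n is the affine
    map x |-> (1 + p k) x + 1. *)
Section Twist.

Variables (n d : {perm T}) (x0 : T) (k : nat).
Hypotheses (regn : regular_on S <[n]>%G) (Sx0 : x0 \in S).
Hypotheses (dS : d \in perm.Sym S) (dx0 : d x0 = x0).
Hypothesis (nd : n ^ d = n ^+ (1 + p * k)).
Let on : #[n] = (p ^ 2)%N. Proof. exact: regular_order. Qed.
Let nS : n \in perm.Sym S.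
Proof. by case: regn => /subsetP sNS _ _; rewrite sNS ?cycle_id. Qed.

Lemma twist_expp : d ^+ p = 1.
Proof.
have [_ trn _] := regn.
apply: (Sym_centralizer_stab trn (groupX _ dS) Sx0).
  exact: perm_expg_fix.
apply: cent_cycle_conj; rewrite (conj_expg_iter _ nd).
apply/eqP; rewrite -{2}(expg1 n) expg_mod_p2 // expn_1p mulnA.
by rewrite -[(p * p)%N]/(p ^ 2)%N -modnDmr modnMr addn0.
Qed.

Lemma twist_prod_expp : (d * n) ^+ p = n ^+ p.
Proof.
rewrite (twist_expg _ nd) twist_expp mul1g; apply/eqP.
by rewrite expg_mod_p2 // sum_expn_1p.
Qed.

Lemma twist_conj : (d * n) ^ d = (d * n) ^+ (1 + p * k).
Proof.
rewrite conjMg conjgE mulKg nd !expgD !expg1 mulgA; congr (_ * _).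
by rewrite !expgM twist_prod_expp.
Qed.

(** If a power of d * n has a fixed point, so has its p-th power, which is a
    power of n by [twist_prod_expp] and hence trivial. The exponent is then a
    multiple of p, so that the power of d * n was itself a power of n. *)
Lemma twist_regular : regular_on S <[d * n]>%G.
Proof.
have cS : d * n \in perm.Sym S by rewrite groupM.
have nb i : ((p ^ 2 %| i * p) = (p %| i))%N by rewrite -mulnn dvdn_pmul2r.
have cE i : (d * n) ^+ (i * p) = n ^+ (i * p).
  by rewrite mulnC !expgM twist_prod_expp.
have fr x i : x \in S -> ((d * n) ^+ i) x = x -> (d * n) ^+ i = 1.
  move=> Sx cx; have nx j : n ^+ j \in <[n]> by rewrite mem_cycle.
  have: n ^+ (i * p) = 1.
    apply: (regular_free regn Sx) => //; rewrite -cE expgM.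
    exact: perm_expg_fix.
  move/eqP; rewrite -order_dvdn on nb => /dvdnP[j Ej]; move: cx.
  by rewrite Ej cE => cx; apply: (regular_free regn Sx).
have oc : #[d * n] = (p ^ 2)%N.
  have : (#[d * n] %| p ^ 2)%N.
    by rewrite order_dvdn -mulnn cE mulnn -on expg_order.
  case/(dvdn_pfactor _ _ pr_p)=> [e]; rewrite leq_eqVlt => /predU1P[-> // | e2 oe].
  have: (#[d * n] %| 1 * p)%N.
    by rewrite oe mul1n -[X in (_ %| X)%N]expn1 dvdn_exp2l.
  by rewrite order_dvdn cE -order_dvdn on nb dvdn1 gtn_eqF ?prime_gt1.
apply: semiregular_regular; rewrite ?cycle_subG ?degree_neq0 //.
  by rewrite -[#|_|]/(#[d * n]) oc.
by move=> x Sx _ /cycleP[i ->]; apply: fr.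
Qed.

(** In coordinates u is multiplication by b. It commutes with d and sends
    d * n to d * n ^+ b, whereas (d * n) ^+ b is d ^+ b * n ^+ b up to a power
    of n ^+ p = (d * n) ^+ p. Whether u normalizes <[d * n]> is thus decided by
    the discrepancy d * d ^- b. *)
Lemma twist_conj_stab u b : u \in perm.Sym S -> u x0 = x0 -> n ^ u = n ^+ b ->
  exists2 z, z \in <[d * n]> & (d * n) ^ u = d * d ^- b * z.
Proof.
move=> uS ux0 nu.
have -> : (d * n) ^ u = d * n ^+ b.
  rewrite conjMg nu; congr (_ * _).
  apply/conjg_fixP/commgP; apply: (stab_conj_inj regn Sx0).
  - exact: groupM.
  - exact: groupM.
  - by rewrite permM dx0.
  - by rewrite permM ux0.
  by rewrite !conjgM nd nu !conjXg nd nu -!expgM mulnC.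
set s := (\sum_(j < b) (1 + p * k) ^ j)%N.
(* s = b modulo p; the multiple p * s makes the difference with s nonnegative *)
have [t Et] : exists t, (b + p * s = s + p * t)%N.
  have le_s : (s <= b + p * s)%N.
    by rewrite (leq_trans _ (leq_addl _ _)) // leq_pmull.
  have: (b + p * s == s %[mod p])%N.
    by rewrite addnC mulnC modnMDl sum_expn_1p_modp.
  rewrite eqn_mod_dvd // => /dvdnP[t Et]; exists t.
  by rewrite (mulnC p t) -Et subnKC.
exists ((d * n) ^+ (b + p * t) * (d * n) ^- (p * s)).
  by rewrite groupM ?groupV ?mem_cycle.
rewrite expgD !(expgM _ p) !twist_prod_expp -!expgM (twist_expg _ nd) -/s.
rewrite -!mulgA mulKg (mulgA _ (n ^+ (p * t))) -expgD -Et expgD mulgK.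
by [].
Qed.

End Twist.

(** The p-part of the order of G is p^2 times that of a point stabilizer, so
    the orbits of P have at least p^2 points. *)
Lemma Sylow_transitive (G P : {group {perm T}}) :
  [transitive G, on S | 'P] -> p.-Sylow(G) P -> [transitive P, on S | 'P].
Proof.
move=> trG sylP; have [sPG pP _] := and3P sylP.
have /set0Pn[x Sx] := degree_neq0.
have oS : orbit 'P G x = S by apply: (atransP trG).
apply/imsetP; exists x => //; apply/eqP; rewrite eq_sym eqEcard.
rewrite -{1}oS imsetS //= cardS -(leq_pmul2r (cardG_gt0 'C_P[x | 'P])).
rewrite card_orbit_stab (card_Hall sylP) -(card_orbit_stab 'P G x) oS cardS.
rewrite partnM ?expn_gt0 ?p_gt0 ?cardG_gt0 // part_pnat_id ?pnatX ?pnat_id //.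
rewrite leq_pmul2l ?expn_gt0 ?p_gt0 // dvdn_leq ?part_gt0 //.
rewrite -(part_pnat_id (pgroupS (subsetIl _ _) pP)).
by rewrite partn_dvd ?cardG_gt0 // cardSg // setSI.
Qed.

(** The regular subgroup C is a set of representatives for the point
    stabilizer in G, so that these two subgroups generate G. *)
Lemma subset_stab_regular (G C K : {group {perm T}}) x : x \in S ->
    G \subset perm.Sym S -> regular_on S C -> C \subset G -> C \subset K ->
  (forall u, u \in G -> u x = x -> u \in K) -> G \subset K.
Proof.
move=> Sx /subsetP sGS regC /subsetP sCG /subsetP sCK stabK.
apply/subsetP=> g Gg.
have [|c Cc cx] := regular_ex regC Sx (_ : g x \in S).
  by rewrite Sym_stable ?sGS.
rewrite -(mulgKV c g); apply: groupM (sCK _ Cc); apply: stabK.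
  by rewrite groupM // groupV; apply: sCG.
by rewrite permM -cx permK.
Qed.

(** A Sylow p-subgroup of G is transitive, so that it contains an element c
    agreeing with n at x: write c = d * n. If d is in G then so is n, and <[n]>
    is normal. Otherwise <[d]>, of prime order, meets G trivially, which kills
    the discrepancy in [twist_conj_stab], and <[c]> is normal. *)
Lemma regular_cyclic_normal (G N : {group {perm T}}) :
    G \subset perm.Sym S -> [transitive G, on S | 'P] ->
    regular_on S N -> cyclic N -> G \subset 'N(N) ->
  exists c, [/\ c \in G, <[c]> <| G & regular_on S <[c]>%G].
Proof.
move=> sGS trG regN /cyclicP[n defN] nNG.
have {defN} defN : N = <[n]>%G by apply: val_inj.
rewrite {N}defN in regN nNG.
have /set0Pn[x Sx] := degree_neq0.
have on := regular_order regN.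
have nS : n \in perm.Sym S by case: regN => /subsetP-> //; apply: cycle_id.
have [P sylP] := Sylow_exists p G; have [sPG pP _] := and3P sylP.
have [|c Pc cx] := atransP2 (Sylow_transitive trG sylP) Sx (_ : n x \in S).
  by rewrite Sym_stable.
have {}cx : c x = n x by rewrite cx.
have Gc := subsetP sPG c Pc.
have /p_natP[j oc] : p.-nat #[c] := mem_p_elt pP Pc.
have [k nc] : exists k, n ^ c = n ^+ (1 + p * k).
  by apply: (p_elt_conj_exp (j := j) on); rewrite ?(subsetP nNG) // -oc expg_order.
have cS := subsetP sGS c Gc.
set d := c * n^-1; have Ec : d * n = c by rewrite mulgKV.
have dS : d \in perm.Sym S by rewrite groupM ?groupV.
have dx : d x = x by rewrite permM cx permK.
have nd : n ^ d = n ^+ (1 + p * k).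
  by rewrite conjgM nc; apply/conjg_fixP/commgP/commuteV/commute_sym/commuteX.
have [Gd | G'd] := boolP (d \in G).
  have Gn : n \in G by rewrite -(mulKg d n) Ec groupM ?groupV.
  by exists n; split=> //; rewrite /normal cycle_subG Gn.
have regc : regular_on S <[c]>%G by rewrite -Ec; apply: twist_regular Sx _ _ nd.
exists c; split=> //; rewrite /normal cycle_subG Gc /=.
apply: (subset_stab_regular (K := 'N(<[c]>)%G) Sx sGS regc).
- by rewrite cycle_subG.
- exact: (normG <[c]>%G).
move=> u Gu ux; have [b _ nu] := cycle_conj_exp (subsetP nNG u Gu).
have [z zc] := twist_conj_stab regN Sx dS dx nd (subsetP sGS u Gu) ux nu.
rewrite Ec in zc *; move=> Ecu.
have G_d : d * d ^- b \in <[d]> :&: G.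
  rewrite inE groupM ?groupV ?mem_cycle ?cycle_id //=.
  rewrite -(mulgK z (d * _)) -Ecu groupM ?groupJ ?groupV //.
  by apply: (subsetP _ _ zc); rewrite cycle_subG.
have od : prime #[d].
  rewrite (nt_prime_order pr_p (twist_expp regN Sx dS dx nd)) //.
  by apply: contraNneq G'd => ->.
have d1 : d * d ^- b = 1.
  apply/eqP; apply: contraR G'd => d1; rewrite -cycle_subG prime_meetG //.
  by apply: contraNneq d1 => dG; rewrite dG in G_d; apply/eqP/set1P.
by rewrite inE -cycleJ cycle_subG /= Ecu d1 mul1g.
Qed.

(** The stabilizer of a point in C is characteristic in C, hence normal in
    the transitive group G; as it fixes one point, it fixes them all. *)
Lemma normal_cyclic_regular (G C : {group {perm T}}) :
    G \subset perm.Sym S -> [transitive G, on S | 'P] ->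
  C <| G -> cyclic C -> #|C| = (p ^ 2)%N -> regular_on S C.
Proof.
move=> sGS trG nCG cycC cardC; have [sCG _] := andP nCG.
apply: semiregular_regular; rewrite ?degree_neq0 ?cardC ?cardS //.
  exact: subset_trans sGS.
move=> x Sx c Cc cx; set D := <[c]>%G.
have nDG : D <| G.
  case/cyclicP: cycC => n Dn; apply: char_normal_trans nCG.
  by rewrite Dn cycle_subgroup_char // -Dn cycle_subG.
apply/permP=> y; rewrite perm1.
have cS : c \in perm.Sym S by rewrite (subsetP sGS) ?(subsetP sCG).
have [Sy|/(Sym_out cS)//] := boolP (y \in S).
have [g Gg ->] := atransP2 trG Sx Sy.
have : c ^ (g^-1) \in D.
  by rewrite memJ_norm ?cycle_id // groupV (subsetP (normal_norm nDG)).
case/cycleP=> i Ei; rewrite /= /aperm -permM conjgCV Ei permM; congr (g _).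
exact: perm_expg_fix.
Qed.

(** In the coordinate i |-> (c ^+ i) x on S, this is multiplication by the
    unit a. *)
Lemma stab_power_map (c : {perm T}) x a :
    regular_on S <[c]>%G -> x \in S -> coprime (p ^ 2) a ->
  exists e, [/\ e \in perm.Sym S, e x = x & c ^ e = c ^+ a].
Proof.
move=> regc Sx co_a.
have oc := regular_order regc.
have cS : c \in perm.Sym S by case: regc => /subsetP-> //; apply: cycle_id.
pose f y := if [pick i : 'I_(p ^ 2) | (c ^+ i) x == y] is Some i
            then (c ^+ (i * a)) x else y.
have xS i : (c ^+ i) x \in S by rewrite Sym_stable ?groupX.
have eqx i j : ((c ^+ i) x == (c ^+ j) x) = (i == j %[mod p ^ 2])%N.
  rewrite -(expg_mod_p2 _ _ oc); apply/eqP/eqP => [|-> //].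
  by apply: (regular_inj regc Sx); rewrite mem_cycle.
have fS i : f ((c ^+ i) x) = (c ^+ (i * a)) x.
  rewrite /f; case: pickP => [j | none].
    rewrite eqx => /eqP ij; apply/eqP; rewrite eqx.
    by rewrite -modnMml ij modnMml.
  have lti : (i %% p ^ 2 < p ^ 2)%N by rewrite ltn_mod expn_gt0 p_gt0.
  by have := none (Ordinal lti); rewrite eqx /= modn_mod eqxx.
have fO y : y \notin S -> f y = y.
  move=> S'y; rewrite /f; case: pickP => // j /eqP E.
  by rewrite -E xS in S'y.
have exi y : y \in S -> exists i, y = (c ^+ i) x.
  by move=> Sy; have [_ /cycleP[i ->] <-] := regular_ex regc Sx Sy; exists i.
have f_inj : injective f.
  move=> y z.
  have [/exi[i ->]|S'y] := boolP (y \in S);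
    have [/exi[j ->]|S'z] := boolP (z \in S).
  - rewrite !fS => /eqP; rewrite eqx => ij; apply/eqP; rewrite eqx.
    rewrite -(expg_mod_p2 _ _ oc) in ij *.
    move: ij; rewrite !expgM => /eqP E.
    have co : coprime #|<[c]>| a by rewrite -orderE oc.
    rewrite -(expg_mod_p2 _ _ oc); apply/eqP.
    exact: (can_in_inj (expgK co) (mem_cycle c i) (mem_cycle c j) E).
  - by rewrite fS fO // => E; rewrite -E xS in S'z.
  - by rewrite fS fO // => E; rewrite E xS in S'y.
  - by rewrite !fO.
exists (perm f_inj); split.
- rewrite inE; apply/subsetP=> y; rewrite inE permE; apply: contraR => /fO ->.
  by rewrite eqxx.
- by rewrite permE -{1}[x](perm1 x) -(expg0 c) fS mul0n perm1.
apply: (mulgI (perm f_inj)); rewrite -conjgC; apply/permP=> y.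
have [/exi[i ->]|S'y] := boolP (y \in S); last first.
  by rewrite !permM !permE (Sym_out cS S'y) !fO // (Sym_out (groupX a cS) S'y).
by rewrite !permM !permE fS -!permM -expgSr fS -expgD mulSn addnC.
Qed.

Section Count.

Variables (G : {group {perm T}}) (c : {perm T}).
Hypotheses (sGS : G \subset perm.Sym S) (Gc : c \in G).
Hypotheses (nCG : <[c]> <| G) (regc : regular_on S <[c]>%G).

Let admissible N := [/\ regular_on S N, cyclic N & G \subset 'N(N)].
Let oc : #[c] = (p ^ 2)%N. Proof. exact: regular_order. Qed.
Let cS : c \in perm.Sym S. Proof. exact: (subsetP sGS). Qed.

(** If the element n' of N agrees with c at x, then c = d' * n' for some d'
    fixing x, and d is the inverse of d'; the point is that n' generates N. *)
Lemma normalized_regular_twist x N : x \in S -> admissible N -> exists d k,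
  [/\ d \in perm.Sym S, d x = x, c ^ d = c ^+ (1 + p * k), d ^+ p = 1
    & N = <[d * c]>%G].
Proof.
move=> Sx [regN cycN nNG].
case/cyclicP: cycN => n defN; have {}defN : N = <[n]>%G by apply: val_inj.
rewrite {N}defN in regN nNG *; have on := regular_order regN.
have nS : n \in perm.Sym S by case: regN => /subsetP-> //; apply: cycle_id.
have [k nc] : exists k, n ^ c = n ^+ (1 + p * k).
  by apply: (p_elt_conj_exp (j := 2) on); rewrite ?(subsetP nNG) // -oc expg_order.
have [|m /cycleP[i ->] ix] := regular_ex regN Sx (_ : c x \in S).
  by rewrite Sym_stable.
set d := c * n ^- i; have Ec : d * n ^+ i = c by rewrite mulgKV.
have dS : d \in perm.Sym S by rewrite groupM ?groupV ?groupX.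
have dx : d x = x by rewrite permM -ix permK.
have nd : n ^ d = n ^+ (1 + p * k).
  by rewrite conjgM nc; apply/conjg_fixP/commgP/commuteV/commute_sym/commuteX2.
have dp := twist_expp regN Sx dS dx nd.
(* If p divides i then n ^+ i commutes with d, so that c ^+ p is the product of
   d ^+ p = 1 and n ^+ (i * p) = 1. *)
have co_i : coprime #[n] i.
  rewrite on coprimeXl // prime_coprime //; apply/negP => /dvdnP[j Ej].
  have ci : commute d (n ^+ i).
    apply: conj_fix_commute; rewrite conjXg nd -expgM; apply/eqP.
    have -> : ((1 + p * k) * i = j * k * p ^ 2 + i)%N by rewrite Ej -mulnn; lia.
    by rewrite expg_mod_p2 // modnMDl.
  have: c ^+ p == 1.
    rewrite -Ec expgMn // dp mul1g -expgM Ej -mulnA mulnn mulnC expgM -on.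
    by rewrite expg_order expg1n.
  rewrite -order_dvdn oc => /dvdn_leq; rewrite prime_gt0 // => /(_ isT).
  by rewrite leqNgt -{1}(expn1 p) ltn_exp2l ?prime_gt1.
have defN : <[n]>%G = <[n ^+ i]>%G.
  by apply: val_inj; apply/eqP; rewrite /= -/(generator _ _) generator_coprime.
rewrite defN in regN *.
have nid : (n ^+ i) ^ d = (n ^+ i) ^+ (1 + p * k).
  by rewrite conjXg nd -!expgM mulnC.
have := twist_conj regN Sx dS dx nid; rewrite Ec => cd.
have [k' cdV] : exists k', c ^ d^-1 = c ^+ (1 + p * k').
  apply: (p_elt_conj_exp (j := 1) oc); rewrite ?expn1 ?expgVn ?dp ?invg1 //.
  by rewrite groupV inE -cycleJ cycle_subG cd mem_cycle.
exists d^-1, k'; split=> //; rewrite ?groupV ?expgVn ?dp ?invg1 //.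
- by rewrite -{1}dx permK.
- by apply: val_inj; rewrite /= -Ec mulKg.
Qed.

Lemma stab_generator x : x \in S ->
  exists e, [/\ e \in perm.Sym S, e x = x, c ^ e = c ^+ (1 + p) & #[e] = p].
Proof.
move=> Sx; have co : coprime (p ^ 2) (1 + p).
  by rewrite coprimeXl // add1n coprimenS.
have [e [eS ex ce]] := stab_power_map regc Sx co.
exists e; split=> //; apply: nt_prime_order => //.
  by apply: (twist_expp regc Sx eS ex (k := 1)); rewrite muln1.
apply/eqP=> e1; move: ce; rewrite e1 conjg1 -{1}(expg1 c) => /eqP.
have lt_p : (p < p ^ 2)%N by rewrite -{1}(expn1 p) ltn_exp2l ?prime_gt1.
rewrite expg_mod_p2 // -{1}(addn0 1%N) eqn_modDl mod0n modn_small //.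
by rewrite eq_sym eqn0Ngt p_gt0.
Qed.

Lemma stab_generator_expg e x u k : x \in S -> e \in perm.Sym S -> e x = x ->
    c ^ e = c ^+ (1 + p) -> u \in perm.Sym S -> u x = x ->
  c ^ u = c ^+ (1 + p * k) -> u = e ^+ k.
Proof.
move=> Sx eS ex ce uS ux cu; apply: (stab_conj_inj regc Sx); rewrite ?groupX //.
  exact: perm_expg_fix.
rewrite cu (conj_expg_iter _ ce); apply/eqP.
by have := expn_1p p 1 k; rewrite expg_mod_p2 // !muln1 mulnC => ->.
Qed.

(** Membership of the discrepancy d * d ^- b in the regular group <[d * c]>
    forces it to be 1, since it fixes x. *)
Lemma stab_normalizes_twist d k x u b : x \in S -> d \in perm.Sym S -> d x = x ->
    c ^ d = c ^+ (1 + p * k) -> u \in G -> u x = x -> c ^ u = c ^+ b ->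
  (u \in 'N(<[d * c]>)) = (d ^+ b == d).
Proof.
move=> Sx dS dx cd Gu ux cu.
have uS := subsetP sGS u Gu.
have [z zN Ez] := twist_conj_stab regc Sx dS dx cd uS ux cu.
have regN := twist_regular regc Sx dS dx cd.
rewrite inE -cycleJ cycle_subG Ez groupMr //.
apply/idP/eqP=> [dN | ->]; last by rewrite mulgV group1.
apply/eqP; rewrite eq_sym eq_mulgV1; apply/eqP.
apply: (regular_free regN Sx) => //.
by rewrite permM dx -{1}(perm_expg_fix b dx) permK.
Qed.

Lemma twist_admissible d k x : x \in S -> d \in perm.Sym S -> d x = x ->
    c ^ d = c ^+ (1 + p * k) ->
    (forall u b, u \in G -> u x = x -> c ^ u = c ^+ b -> d ^+ b = d) ->
  admissible <[d * c]>%G.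
Proof.
move=> Sx dS dx cd stab; have regN := twist_regular regc Sx dS dx cd.
split=> //; first exact: cycle_cyclic.
apply: (subset_stab_regular (K := 'N(<[d * c]>)%G) Sx sGS regc).
- by rewrite cycle_subG.
- rewrite cycle_subG /= -{1}(mulKg d c) groupM //; last first.
    by rewrite (subsetP (normG <[d * c]>%G)) ?cycle_id.
  rewrite groupV inE -cycleJ cycle_subG (twist_conj regc Sx dS dx cd).
  exact: mem_cycle.
move=> u Gu ux; have [b _ cu] := cycle_conj_exp (subsetP (normal_norm nCG) u Gu).
by rewrite (stab_normalizes_twist Sx dS dx cd Gu ux cu) (stab _ _ Gu ux cu).
Qed.

(** Let e be multiplication by 1 + p. By [normalized_regular_twist] the
    admissible groups are the <[e ^+ k * c]> such that k b = k modulo p whenever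
    the stabilizer of x, of order m, contains a multiplication by b. If m is 1
    or p, all these b are 1 modulo p and every k is allowed. Otherwise the
    stabilizer is not contained in <[e]>, so that some b is not 1 modulo p,
    which leaves k = 0. *)
Lemma count_regular_cyclic m : #|G| = (p ^ 2 * m)%N ->
  exists F : 'I_(if (m == 1%N) || (m == p) then p else 1%N) -> {group {perm T}},
  [/\ injective F, forall i, admissible (F i)
    & forall N, admissible N -> exists i, N = F i].
Proof.
move=> cardG; have /set0Pn[x Sx] := degree_neq0.
have [e [eS ex ce oe]] := stab_generator Sx.
have cardGx : #|'C_G[x | 'P]| = m.
  have := card_orbit_stab 'P G x; rewrite (_ : orbit 'P G x = S).
    by rewrite cardG cardS => /eqP; rewrite eqn_pmul2l ?expn_gt0 ?p_gt0 // => /eqP.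
  have trG: [transitive G, on S | 'P].
    case: regc => _ trC _; apply/imsetP; exists x => //; apply/eqP.
    rewrite eqEsubset acts_sub_orbit ?Sym_acts // Sx andbT.
    by rewrite -(atransP trC _ Sx) imsetS // cycle_subG.
  exact: (atransP trG).
have fixX i : (e ^+ i) x = x by apply: perm_expg_fix.
have exp1p b : (exists k, c ^+ b = c ^+ (1 + p * k)) -> (b = 1 %[mod p])%N.
  case=> k /eqP; rewrite expg_mod_p2 // => /eqP bk.
  have dp : (p %| p ^ 2)%N by rewrite dvdn_mulr.
  by rewrite -(modn_dvdm b dp) bk modn_dvdm // addnC mulnC modnMDl.
have ceX i : c ^ (e ^+ i) = c ^+ (1 + p * i).
  rewrite (conj_expg_iter _ ce); apply/eqP.
  by have := expn_1p p 1 i; rewrite expg_mod_p2 // !muln1 mulnC => ->.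
case: ifP => [m1p | m1p].
  have Gx_p u b : u \in G -> u x = x -> c ^ u = c ^+ b -> (b = 1 %[mod p])%N.
    move=> Gu ux cu; apply: exp1p.
    have: #[u] %| p.
      apply: (@dvdn_trans m); last by case/pred2P: m1p => ->; rewrite ?dvd1n.
      by rewrite -cardGx cardSg // cycle_subG inE Gu; apply/astab1P.
    rewrite order_dvdn => /eqP up.
    rewrite -cu; apply: (p_elt_conj_exp (j := 1) oc); rewrite ?expn1 //.
    by rewrite (subsetP (normal_norm nCG)).
  pose F (i : 'I_p) := <[e ^+ i * c]>%G; exists F; split.
  - move=> i j Fij.
    have regF := twist_regular regc Sx (groupX i eS) (fixX i) (ceX i).
    have Fj : e ^+ j * c \in F i by rewrite Fij cycle_id.
    have /(regular_inj regF Sx (cycle_id _) Fj) : (e ^+ i * c) x = (e ^+ j * c) x.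
      by rewrite !permM !fixX.
    move/mulIg/eqP; rewrite eq_expg_mod_order oe !modn_small // => /eqP.
    exact: val_inj.
  - move=> i; apply: (twist_admissible Sx (groupX i eS) (fixX i) (ceX i)).
    move=> u b Gu ux cu.
    apply/eqP; rewrite -expgM eq_expg_mod_order oe -modnMmr (Gx_p u b) //.
    by rewrite modnMmr muln1.
  move=> N gN; have [d [k [dS dx cd dp ->]]] := normalized_regular_twist Sx gN.
  have lt_kp : (k %% p < p)%N by rewrite ltn_mod p_gt0.
  exists (Ordinal lt_kp); congr <[_ * c]>%G => /=.
  by rewrite (stab_generator_expg Sx eS ex ce dS dx cd) -oe expg_mod_order.
exists (fun=> <[c]>%G); split=> [i j _ | i | N gN].
- by rewrite !ord1.
- by split; rewrite ?cycle_cyclic ?normal_norm.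
exists ord0; have [d [k [dS dx cd dp defN]]] := normalized_regular_twist Sx gN.
suff d1 : d = 1 by rewrite defN d1 mul1g.
apply: contraFeq m1p => d_neq1.
have sGxe : 'C_G[x | 'P] \subset <[e]>.
  apply/subsetP=> u /setIP[Gu /astab1P ux].
  have [b b_gt0 cu] := cycle_conj_exp (subsetP (normal_norm nCG) u Gu).
  have /eqP : d ^+ b == d.
    rewrite -(stab_normalizes_twist Sx dS dx cd Gu ux cu).
    case: gN => _ _ /subsetP nN.
    by rewrite defN in nN; apply: nN.
  rewrite -{2}(expg1 d) => /eqP; rewrite eq_expg_mod_order.
  rewrite (nt_prime_order pr_p dp d_neq1) => /eqP b1.
  have [j Ej] := modp1_witness b_gt0 b1; rewrite Ej in cu.
  by rewrite (stab_generator_expg Sx eS ex ce (subsetP sGS u Gu) ux cu) mem_cycle.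
have := cardSg sGxe; rewrite cardGx -orderE oe.
by case/primeP: pr_p => _ /[apply].
Qed.

End Count.

End Degree.

(** * Semidirect products inside the holomorph *)

(** The hypothesis on the centralizer says that K embeds in the automorphism
    group of C by conjugation; f transports this embedding to Z. *)
Lemma sdprod_isog_hol (gT rT : finGroupType) (G C K : {group gT})
    (f : {morphism C >-> rT}) (Z : {group rT}) :
    C ><| K = G -> 'C_K(C) = 1 -> 'injm f -> f @* C = Z ->
  exists M : {group {perm rT}},
    [/\ M \subset Aut Z, #|M| = #|K| & G \isog hol_sdprod Z M].
Proof.
move=> defG cKC injf imf; have {Z imf}-> : Z = (f @* C)%G by apply: val_inj.
have [_ _ nCK tiCK] := sdprodP defG.
set Z := (f @* C)%G; set to := [Aut Z]%gact.
pose aut_f := Aut_isom injf (subxx C).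
pose alpha := restrm nCK (conj_aut C).
have alphaE : {in C & K, forall x k, alpha k x = x ^ k}.
  by move=> x k Cx Kk; rewrite /alpha /restrm norm_conj_autE ?(subsetP nCK).
have sKalpha : K \subset alpha @*^-1 Aut C.
  rewrite -sub_morphim_pre //; apply/subsetP=> _ /morphimP[k _ Kk ->].
  exact: Aut_aut.
pose beta := restrm sKalpha (aut_f \o alpha).
have inj_beta : 'injm beta.
  apply: injm_restrm; apply: injm_comp.
    by rewrite /alpha ker_restrm ker_conj_aut cKC.
  exact: injm_Aut_isom.
have betaA k : beta k \in Aut Z by apply: Aut_Aut_isom.
have betaE : {in C & K, forall x k, beta k (f x) = f (x ^ k)}.
  move=> x k Cx Kk; rewrite /beta /restrm /= /aut_f Aut_isomE //.
    by rewrite alphaE.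
  exact: Aut_aut.
have sC1 : C \subset f @*^-1 Z by rewrite -sub_morphim_pre.
have sK2 : K \subset beta @*^-1 Aut Z.
  by rewrite -sub_morphim_pre //; apply/subsetP=> _ /morphimP[k _ Kk ->].
pose fC := restrm sC1 (sdpair1 to \o f).
pose fK := restrm sK2 (sdpair2 to \o beta).
have actf : {in C & K, morph_act 'J 'J fC fK}.
  move=> x k Cx Kk; rewrite /= /fC /fK /restrm /=.
  rewrite -sdpair_act //=; last exact: mem_morphim.
  by rewrite -betaE // /actby /= autactE //.
pose M := (beta @* K)%G.
exists M; split.
- by apply/subsetP=> _ /morphimP[k _ Kk ->].
- exact: card_injm.
have imC : fC @* C = sdpair1 to @* Z.
  by rewrite morphim_restrm setIid morphim_comp.
have imK : fK @* K = sdpair2 to @* M.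
  by rewrite morphim_restrm setIid morphim_comp.
apply/isogP; exists [morphism of sdprodm defG actf] => /=.
  rewrite injm_sdprodm imC imK; apply/and3P; split.
  - apply: injm_restrm; apply: injm_comp => //; exact: injm_sdpair1.
  - apply: injm_restrm; apply: injm_comp => //; exact: injm_sdpair2.
  rewrite -subG1 -(im_sdpair_TI to) setISS ?morphimS //.
  by apply/subsetP=> _ /morphimP[k _ Kk ->].
rewrite im_sdprodm imC imK norm_joinEr //.
apply: subset_trans (im_sdpair_norm to); apply: morphimS.
by apply/subsetP=> _ /morphimP[k _ Kk ->].
Qed.

Lemma hol_sdprod_normal (rT : finGroupType) (Z : {group rT})
    (M : {group {perm rT}}) :
  M \subset Aut Z ->
  [/\ sdpair1 [Aut Z]%gact @* Z <| hol_sdprod Z M,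
      sdpair1 [Aut Z]%gact @* Z \isog Z
    & #|hol_sdprod Z M| = (#|Z| * #|M|)%N].
Proof.
move=> sMA; set to := [Aut Z]%gact.
have nZM : sdpair2 to @* M \subset 'N(sdpair1 to @* Z).
  exact: subset_trans (morphimS _ sMA) (im_sdpair_norm to).
have tiZM : sdpair1 to @* Z :&: sdpair2 to @* M = 1.
  by apply/trivgP; rewrite -(im_sdpair_TI to) setIS ?morphimS.
split.
- by rewrite /normal joing_subl join_subG normG.
- by rewrite isog_sym sub_isog ?injm_sdpair1.
rewrite /= norm_joinEr // TI_cardMg //.
by rewrite !card_injm ?injm_sdpair1 ?injm_sdpair2.
Qed.

Lemma Zp_cyclic n : cyclic (Zp n).
Proof.
rewrite /Zp; case: ifP => _; last exact: cyclic1.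
by apply/cyclicP; exists Zp1; apply: Zp_cycle.
Qed.

Lemma isog_cyclic_sdprodP (gT : finGroupType) (G : {group gT}) n m : (0 < n)%N ->
    isog_cyclic_sdprod G n m ->
  #|G| = (n * m)%N /\ exists C : {group gT}, [/\ C <| G, cyclic C & #|C| = n].
Proof.
move=> n_gt0 [M [sMA cM isoG]].
have [nZ isoZ cH] := hol_sdprod_normal sMA.
have cZ : #|Zp_group n| = n by apply: card_Zp.
split; first by rewrite (card_isog isoG) cH cM cZ.
have [f injf imf] := isogP (isog_symr isoG).
set Z := sdpair1 _ @* _ in nZ isoZ.
have sZ := normal_sub nZ.
exists (f @* Z)%G; split.
- by rewrite /= -imf morphim_normal.
- by rewrite /= morphim_cyclic // (isog_cyclic isoZ) Zp_cyclic.
by rewrite /= card_injm // (card_isog isoZ) cZ.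
Qed.

Lemma isog_cyclic_sdprod_isog (gT rT : finGroupType) (G : {group gT})
    (H : {group rT}) n m :
  G \isog H -> isog_cyclic_sdprod H n m -> isog_cyclic_sdprod G n m.
Proof.
by move=> isoGH [M [sMA cM isoH]]; exists M; split=> //; apply: isog_trans isoH.
Qed.

Section SdprodDegree.

Variables (T : finType) (S : {set T}) (p : nat).
Hypotheses (pr_p : prime p) (p_odd : odd p) (cardS : #|S| = (p ^ 2)%N).

(** A point stabilizer is a complement of the regular subgroup <[c]>, and
    acts on it faithfully by [Sym_centralizer_stab]. *)
Lemma regular_normal_cyclic_sdprod (G : {group {perm T}}) c :
    G \subset perm.Sym S -> [transitive G, on S | 'P] -> c \in G ->
    <[c]> <| G -> regular_on S <[c]>%G ->
  exists2 m, (m %| p * p.-1)%N & isog_cyclic_sdprod G (p ^ 2) m.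
Proof.
move=> sGS trG Gc nCG regc.
have /set0Pn[x Sx] := degree_neq0 pr_p cardS.
have oc := regular_order pr_p cardS regc.
have p2_gt0 : (0 < p ^ 2)%N by rewrite expn_gt0 prime_gt0.
pose K := 'C_G[x | 'P]%G.
have defG : <[c]> ><| K = G.
  have tiCK : <[c]> :&: K = 1.
    apply/trivgP/subsetP=> d /setIP[cd /setIP[_ /astab1P dx]].
    by apply/set1P; apply: (regular_free regc Sx).
  rewrite sdprodE //; last by rewrite (subset_trans (subsetIl _ _)) // normal_norm.
  apply/eqP; rewrite eqEcard mulG_subG cycle_subG Gc subsetIl /=.
  rewrite TI_cardMg // -orderE oc -cardS -(atransP trG _ Sx).
  by rewrite card_orbit_stab.
have cKC : 'C_K(<[c]>) = 1.
  apply/trivgP/subsetP=> u /setIP[/setIP[Gu /astab1P ux] cu].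
  have [_ trc _] := regc; apply/set1P.
  exact: Sym_centralizer_stab trc (subsetP sGS u Gu) Sx ux cu.
have /isogP[f injf imf] : <[c]> \isog Zp_group (p ^ 2).
  by rewrite isog_cyclic_card ?cycle_cyclic //= Zp_cyclic -orderE oc card_Zp /=.
have [M [sMA cM isoG]] := sdprod_isog_hol defG cKC injf imf.
exists #|K|; last by exists M.
rewrite -cM; apply: dvdn_trans (cardSg sMA) _.
by rewrite card_Aut_cyclic ?Zp_cyclic //= card_Zp // totient_pfactor // mulnC.
Qed.

End SdprodDegree.

(** * Traces and Galois descent *)

Import GRing.Theory.
Local Open Scope ring_scope.

(** The splitting field of the minimal polynomial of a separable generator of
    L is Galois over K and contains L, so that it is Lt. *)
Lemma normal_closure_galois (K : fieldType) (Lt : splittingFieldType K)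
    (L : {subfield Lt}) :
  separable 1 L -> is_normal_closure L -> galois 1 {:Lt}.
Proof.
move=> sepL closL; set a := separable_generator 1 L.
have defL : L = <<1; a>>%VS :> {vspace _}.
  exact: eq_adjoin_separable_generator sepL (sub1v L).
have [r /eqP Dr] := splitting_field_normal 1%AS a.
have galM : galois 1 <<1 & r>>.
  apply/splitting_galoisField; exists (minPoly 1 a); split.
  - exact: minPolyOver.
  - exact: separable_generatorP.
  by exists r => //; rewrite Dr eqpxx.
have [sM sepM nM] := and3P galM.
have <- : <<1 & r>>%VS = {:Lt}%VS.
  apply: (closL <<1 & r>>%AS) => //=; rewrite defL.
  apply/FadjoinP; rewrite sub1v; split=> //; apply: seqv_sub_adjoin.
  by rewrite -root_prod_XsubC -Dr root_minPoly.
exact: galM.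
Qed.

Section Trace.

Variables (K : fieldType) (Lt : splittingFieldType K).
Hypothesis galLt : galois 1 {:Lt}.
Implicit Types (s t : gal_of {:Lt}) (a b l : Lt).

Lemma gal_setT : 'Gal({:Lt} / 1) = [set: gal_of {:Lt}].
Proof. by apply/setP=> s; rewrite inE gal_kHom ?sub1v // k1AHom. Qed.

Lemma mem_gal s : s \in 'Gal({:Lt} / 1). Proof. by rewrite gal_setT inE. Qed.

Lemma galMf s t a : (s * t)%g a = t (s a). Proof. by rewrite galM ?memvf. Qed.

(** Meaningful on the line spanned by 1, which it identifies with K. *)
Definition base_coef : Lt -> K := coord [tuple (1 : Lt)] ord0.

Lemma base_coef_linear : linear (base_coef : Lt -> K^o).
Proof. by move=> k a b; rewrite /base_coef linearP. Qed.

Lemma base_coefK a : a \in 1%VS -> (base_coef a)%:A = a.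
Proof.
case/vlineP=> k ->; rewrite /base_coef linearZ /=.
have fr : free [tuple (1 : Lt)] by rewrite /= seq1_free oner_neq0.
by rewrite (coord_free 0 0 fr) mulr1.
Qed.

Lemma gal_fixed_base a : (forall s, s a = a) -> a \in 1%VS.
Proof.
move=> fa; have /galois_fixedField <- := galLt.
by apply/fixedFieldP; rewrite ?memvf.
Qed.

Definition trace a : Lt := \sum_(s : gal_of {:Lt}) s a.

Lemma trace_gal t a : t (trace a) = trace a.
Proof.
rewrite /trace rmorph_sum [RHS](reindex_inj (mulIg t)) /=.
by apply: eq_bigr => s _; rewrite galMf.
Qed.

Lemma trace_base a : (base_coef (trace a))%:A = trace a.
Proof. by rewrite base_coefK // gal_fixed_base // => s; rewrite trace_gal. Qed.

Lemma gal_indep (c : gal_of {:Lt} -> Lt) :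
  (forall a, \sum_(s : gal_of {:Lt}) c s * s a = 0) -> forall s, c s = 0.
Proof.
by move=> H s; apply: (@gal_independent _ _ _ predT) => // a _; apply: H.
Qed.

(** Dedekind's independence of automorphisms, for the coefficients s a. *)
Lemma trace_nondeg a : (forall l, trace (l * a) = 0) -> a = 0.
Proof.
move=> H; have := @gal_indep (fun s => s a) _ 1%g; rewrite gal_id; apply=> l.
by rewrite -[RHS](H l); apply: eq_bigr => s _; rewrite rmorphM mulrC.
Qed.

Lemma trace_one : exists theta, trace theta = 1.
Proof.
have [|a _ ta] := @gal_independent_contra _ _ {:Lt}%AS predT (fun=> 1) 1%g isT.
  exact: oner_neq0.
have {}ta : trace a != 0.
  apply: contraNneq ta => ta0; apply/eqP; rewrite -[RHS]ta0.
  by apply: eq_bigr => s _; rewrite mul1r.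
exists (a / trace a); rewrite /trace.
rewrite (eq_bigr (fun s : gal_of {:Lt} => s a / trace a)) => [|t _].
  by rewrite -mulr_suml mulfV.
by rewrite rmorphM fmorphV /= trace_gal.
Qed.

(** The d_i are a column of the inverse of the matrix of all s (e_i). *)
Lemma gal_dual : exists r, exists d e : 'I_r -> Lt,
  forall s, \sum_i d i * s (e i) = (s == 1%g)%:R.
Proof.
have [w _ [uM _ _]] := gal_matrix 'Gal({:Lt} / 1)%G.
set M := (\matrix_(i, j) _) in uM.
exists #|'Gal({:Lt} / 1)%G|.
exists (fun j => invmx M j (enum_rank_in (mem_gal 1%g) 1%g)), (tnth w) => s.
have := congr1 (fun A : 'M_ _ => A (enum_rank_in (mem_gal 1%g) s)
  (enum_rank_in (mem_gal 1%g) 1%g)) (mulmxV uM).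
rewrite !mxE (_ : (_ == _) = (s == 1%g)); last first.
  by apply/eqP/eqP => [/enum_rank_in_inj|->] //; apply; apply: mem_gal.
move=> <-.
by apply: eq_bigr => j _; rewrite [M _ _]mxE enum_rankK_in ?mem_gal // mulrC.
Qed.

End Trace.

(** * Evaluation of tensors *)

Lemma linear_fun0 (K : fieldType) (U V : lmodType K) (g : U -> V) :
  linear g -> g 0 = 0.
Proof. by move=> gl; have := gl (-1) 0 0; rewrite scaler0 add0r scaleN1r addNr. Qed.

Lemma linear_funZ (K : fieldType) (U V : lmodType K) (g : U -> V) : linear g ->
  forall k u, g (k *: u) = k *: g u.
Proof. by move=> gl k u; have := gl k u 0; rewrite (linear_fun0 gl) !addr0. Qed.

Lemma linear_fun_sum (K : fieldType) (U V : lmodType K) (g : U -> V)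
    (I : finType) (a : I -> K) (u : I -> U) :
  linear g -> g (\sum_i a i *: u i) = \sum_i a i *: g (u i).
Proof.
move=> gl; elim/big_rec2: _ => [|i x y _ <-]; first exact: linear_fun0.
exact: gl.
Qed.

Section Tlift.

Variables (K : fieldType) (U V : vectType K).
Implicit Types (W : lmodType K) (t : tensor U V).

Lemma eq_tlift W (f g : U -> V -> W) t :
  (forall a b, f a b = g a b) -> tlift f t = tlift g t.
Proof. by move=> fg; apply: eq_bigr => i _; apply: eq_bigr => j _; rewrite fg. Qed.

Lemma tlift_is_linear W (f : U -> V -> W) : linear (tlift f).
Proof.
move=> k t t'; rewrite /tlift scaler_sumr -big_split; apply: eq_bigr => i _.
rewrite scaler_sumr -big_split; apply: eq_bigr => j _ /=.
by rewrite scalerA -scalerDl !mxE.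
Qed.

Lemma tlift_morph W W' (g : W -> W') (f : U -> V -> W) t : linear g ->
  g (tlift f t) = tlift (fun a b => g (f a b)) t.
Proof.
move=> gl; have gD : {morph g : x y / x + y}.
  by move=> x y; have := gl 1 x y; rewrite !scale1r.
have gZ k x : g (k *: x) = k *: g x by apply: linear_funZ.
rewrite /tlift (big_morph g gD (linear_fun0 gl)); apply: eq_bigr => i _.
by rewrite (big_morph g gD (linear_fun0 gl)); apply: eq_bigr => j _; rewrite gZ.
Qed.

Lemma tlift_sum W (I : finType) (P : pred I) (F : I -> U -> V -> W) t :
  tlift (fun a b => \sum_(i | P i) F i a b) t = \sum_(i | P i) tlift (F i) t.
Proof.
rewrite /tlift [RHS]exchange_big; apply: eq_bigr => i _.
by rewrite [RHS]exchange_big; apply: eq_bigr => j _; rewrite scaler_sumr.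
Qed.

Lemma tlift_mull (A : algType K) (x : A) (f : U -> V -> A) t :
  tlift (fun a b => x * f a b) t = x * tlift f t.
Proof.
by rewrite (tlift_morph (g := *%R x)) // => k y z; rewrite mulrDr scalerAr.
Qed.

Lemma tlift_mulr (A : algType K) (x : A) (f : U -> V -> A) t :
  tlift (fun a b => f a b * x) t = tlift f t * x.
Proof.
by rewrite (tlift_morph (g := *%R^~ x)) // => k y z /=; rewrite mulrDl scalerAl.
Qed.

End Tlift.

Lemma tlift_tr (K : fieldType) (U V : vectType K) (W : lmodType K)
    (f : U -> V -> W) (t : tensor U V) :
  tlift f t = tlift (fun b a => f a b) ((t : 'M_(_, _))^T : tensor V U).
Proof.
rewrite /tlift exchange_big; apply: eq_bigr => i _; apply: eq_bigr => j _.
by rewrite mxE.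
Qed.

Section Descent.

Variables (K : fieldType) (Lt : splittingFieldType K).
Hypothesis galLt : galois 1 {:Lt}.

Definition separating (V : lmodType K) (I : Type) (phi : V -> I -> Lt) :=
  forall v, (forall i, phi v i = 0) -> v = 0.

(** Injectivity of the Lt-linear extension of phi to the tensor product of Lt
    and V, written in a basis of V. *)
Definition Lt_free (V : vectType K) (I : Type) (phi : V -> I -> Lt) :=
  forall l : 'I_(\dim {:V}) -> Lt,
    (forall i, \sum_j l j * phi (vbasis {:V})`_j i = 0) -> forall j, l j = 0.

(** Multiply a relation over Lt by x and sum its Galois conjugates. Since the
    conjugates of the values of phi are again values of phi, this is a relation
    with coefficients the traces of the x * l_j, which are in K: they vanish for
    all x, and the trace form is nondegenerate. *)
Lemma fixed_Lt_free (V : vectType K) (I : Type) (phi : V -> I -> Lt) :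
    (forall i, linear (phi^~ i)) -> separating phi ->
    (forall (s : gal_of {:Lt}) i, exists i', forall v, phi v i = s (phi v i')) ->
  Lt_free phi.
Proof.
move=> phil sep_phi phi_fix l l0 j; apply: trace_nondeg => x.
rewrite -(trace_base galLt); set k := fun j => base_coef (trace (x * l j)).
rewrite -/(k j); suff -> : k j = 0 by rewrite scale0r.
have k0 : \sum_j k j *: (vbasis {:V})`_j = 0.
  apply: sep_phi => i; rewrite (linear_fun_sum _ _ (phil i)).
  transitivity (\sum_(s : gal_of {:Lt}) \sum_j s (x * l j) * phi (vbasis {:V})`_j i).
    rewrite exchange_big; apply: eq_bigr => m _ /=.
    by rewrite -mulr_suml -[k m *: _]mulr_algl trace_base.
  apply: big1 => s _; have [i' Ei] := phi_fix s i.
  transitivity (s (x * \sum_j l j * phi (vbasis {:V})`_j i')).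
    rewrite mulr_sumr rmorph_sum; apply: eq_bigr => m _.
    by rewrite Ei mulrA !rmorphM.
  by rewrite l0 mulr0 rmorph0.
by have := coord_sum_free k j (basis_free (vbasisP {:V})); rewrite k0 linear0.
Qed.

(** Freeness over Lt removes the first factor: for each basis vector of V
    there remains an element of W on which psi vanishes. *)
Lemma tlift_eval_inj (V W : vectType K) (I J : Type)
    (phi : V -> I -> Lt) (psi : W -> J -> Lt) (t t' : tensor V W) :
    Lt_free phi -> separating psi -> (forall j, linear (psi^~ j)) ->
    (forall i j, tlift (fun a b => phi a i * psi b j) t =
                 tlift (fun a b => phi a i * psi b j) t') ->
  t = t'.
Proof.
move=> frphi sep_psi psil H; apply/eqP; rewrite -subr_eq0; apply/eqP.
have {H}: forall i j, tlift (fun a b => phi a i * psi b j) (t - t') = 0.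
  move=> i j; have -> : t - t' = -1 *: t' + t by rewrite scaleN1r addrC.
  by rewrite tlift_is_linear H scaleN1r addNr.
move: (t - t') => {t t'} t t0; apply/matrixP=> i j; rewrite mxE.
have w0 : \sum_j (t : 'M_(_, _)) i j *: (vbasis {:W})`_j = 0.
  apply: sep_psi => y; rewrite (linear_fun_sum _ _ (psil y)).
  pose l i := \sum_j (t : 'M_(_, _)) i j *: psi (vbasis {:W})`_j y.
  apply: (frphi l) => x; rewrite -[RHS](t0 x y); apply: eq_bigr => m _.
  rewrite mulr_suml; apply: eq_bigr => q _.
  by rewrite -scalerAl mulrC.
have frW := basis_free (vbasisP {:W}).
by have := coord_sum_free (fun j => (t : 'M_(_, _)) i j) j frW;
  rewrite w0 linear0 => /esym.
Qed.

Lemma tlift_eval_injr (V W : vectType K) (I J : Type)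
    (phi : V -> I -> Lt) (psi : W -> J -> Lt) (t t' : tensor V W) :
    separating phi -> (forall i, linear (phi^~ i)) -> Lt_free psi ->
    (forall i j, tlift (fun a b => phi a i * psi b j) t =
                 tlift (fun a b => phi a i * psi b j) t') ->
  t = t'.
Proof.
move=> sep_phi phil frpsi H; apply: (can_inj (@trmxK _ _ _)).
apply: (tlift_eval_inj frpsi sep_phi phil) => j i.
have E u : tlift (fun b a => psi b j * phi a i) ((u : 'M_(_, _))^T : tensor W V) =
    tlift (fun a b => phi a i * psi b j) u.
  by rewrite [RHS]tlift_tr; apply: eq_tlift => a b; rewrite mulrC.
by rewrite !E.
Qed.

End Descent.

(** * The fixed ring of a twisted group algebra *)

(** A type of its own, which carries the convolution product. *)
Definition grpalg (K : fieldType) (F : fieldExtType K) (gT : finGroupType) :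
  Type := {ffun gT -> F}.

Section GroupAlgebra.

Variables (K : fieldType) (F : fieldExtType K) (gT : finGroupType).
Local Notation A := (grpalg F gT).
Implicit Types c d e : A.

HB.instance Definition _ := Vector.copy A {ffun gT -> F}.

Definition grpalg_one : A := [ffun n => (n == 1%g)%:R].
(** The product of the basis elements n and n' is n' * n, as in
    [grpalg_mul]: for permutations, this is the composite of n after n'. *)
Definition grpalg_conv c d : A :=
  [ffun m => \sum_n (c : {ffun gT -> F}) n * (d : {ffun gT -> F}) (m * n^-1)%g].

Fact grpalg_convA : associative grpalg_conv.
Proof.
move=> c d e; apply/ffunP=> m; rewrite !ffunE.
transitivity (\sum_n \sum_k c n * (d (k * n^-1)%g * e (m * k^-1)%g)).
  apply: eq_bigr => n _; rewrite ffunE mulr_sumr.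
  rewrite [RHS](reindex_inj (mulIg n)) /=; apply: eq_bigr => k _.
  by rewrite mulgK invMg mulgA.
rewrite exchange_big; apply: eq_bigr => k _; rewrite ffunE mulr_suml.
by apply: eq_bigr => n _; rewrite mulrA.
Qed.

Fact grpalg_conv1l : left_id grpalg_one grpalg_conv.
Proof.
move=> c; apply/ffunP=> m; rewrite ffunE (bigD1 1%g) //= ffunE eqxx mul1r.
rewrite invg1 mulg1 big1 ?addr0 // => n /negPf n1.
by rewrite ffunE n1 mul0r.
Qed.

Fact grpalg_conv1r : right_id grpalg_one grpalg_conv.
Proof.
move=> c; apply/ffunP=> m; rewrite ffunE (bigD1 m) //= ffunE mulgV eqxx mulr1.
rewrite big1 ?addr0 // => n n_m.
by rewrite ffunE -eq_mulgV1 eq_sym (negPf n_m) mulr0.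
Qed.

Fact grpalg_convDl : left_distributive grpalg_conv +%R.
Proof.
move=> c d e; apply/ffunP=> m; rewrite !ffunE -big_split.
by apply: eq_bigr => n _; rewrite !ffunE mulrDl.
Qed.

Fact grpalg_convDr : right_distributive grpalg_conv +%R.
Proof.
move=> c d e; apply/ffunP=> m; rewrite !ffunE -big_split.
by apply: eq_bigr => n _; rewrite !ffunE mulrDr.
Qed.

Fact grpalg_one_neq0 : grpalg_one != 0.
Proof.
apply/eqP=> /ffunP/(_ 1%g)/eqP; rewrite !ffunE eqxx.
by rewrite oner_eq0.
Qed.

HB.instance Definition _ := GRing.Zmodule_isNzRing.Build A
  grpalg_convA grpalg_conv1l grpalg_conv1r grpalg_convDl grpalg_convDr
  grpalg_one_neq0.

Fact grpalg_scaleAl k c d : k *: (c * d) = (k *: c) * d.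
Proof.
apply/ffunP=> m; rewrite !ffunE scaler_sumr.
by apply: eq_bigr => n _; rewrite !ffunE scalerAl.
Qed.
HB.instance Definition _ := GRing.Lmodule_isLalgebra.Build K A grpalg_scaleAl.

Fact grpalg_scaleAr k c d : k *: (c * d) = c * (k *: d).
Proof.
apply/ffunP=> m; rewrite !ffunE scaler_sumr.
by apply: eq_bigr => n _; rewrite !ffunE scalerAr.
Qed.
HB.instance Definition _ := GRing.Lalgebra_isAlgebra.Build K A grpalg_scaleAr.

HB.instance Definition _ := Algebra_isFalgebra.Build K A.

Lemma grpalg_mulE c d : c * d = grpalg_conv c d. Proof. by []. Qed.
Lemma grpalg_1E : (1 : A) = grpalg_one. Proof. by []. Qed.

Lemma grpalg_mul_conv (N : {group gT}) c d :
  in_grpalg N c -> in_grpalg N d -> c * d = grpalg_mul N c d :> A.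
Proof.
move=> cN dN; apply/ffunP=> m; rewrite !ffunE.
rewrite [RHS]big_mkcond; apply: eq_bigr => n _.
case: ifPn => [Nn | /cN ->]; last by rewrite mul0r.
have [Nmn | N'mn] := boolP ((m * n^-1)%g \in N).
  rewrite (big_pred1 (m * n^-1)%g) // => k /=.
  by rewrite (can2_eq (mulgK n) (mulgKV n)) andb_idl // => /eqP->.
rewrite dN // mulr0 big1 // => k /andP[Nk /eqP km].
by case/negP: N'mn; rewrite -km mulgK.
Qed.

End GroupAlgebra.

(** The semilinear action of Galois on Lt[N] in which s sends the basis element
    n to n ^ tau s, and the K-algebra of its fixed elements. *)
Section Descended.

Variables (K : fieldType) (Lt : splittingFieldType K) (gT : finGroupType).
Variables (N : {group gT}) (tau : gal_of {:Lt} -> gT).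
Local Notation A := (grpalg Lt gT).
Implicit Types (c d : A) (s t : gal_of {:Lt}).

(** The fixed elements supported in N form the kernel of this linear map,
    which makes them a subspace. *)
Definition descent_defect c : {ffun gal_of {:Lt} * gT -> Lt} :=
  [ffun x => if x.2 \in N then c (x.2 ^ tau x.1)%g - x.1 (c x.2) else c x.2].

Fact descent_defect_linear : linear descent_defect.
Proof.
move=> k c d; apply/ffunP=> -[s n]; rewrite !ffunE /=.
case: ifP => // _; rewrite linearP /= scalerBr opprD addrACA.
by [].
Qed.
HB.instance Definition _ :=
  GRing.isLinear.Build K A {ffun gal_of {:Lt} * gT -> Lt} _
    descent_defect descent_defect_linear.

Definition fixed_space : {vspace A} := lker (linfun descent_defect).

Lemma fixed_spaceP c : reflect
  (in_grpalg N c /\ (forall s n, n \in N -> c (n ^ tau s)%g = s (c n)))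
  (c \in fixed_space).
Proof.
rewrite memv_ker lfunE /=; apply: (iffP eqP) => [/ffunP H | [cN cG]].
  split=> [n N'n | s n Nn]; last first.
    by have := H (s, n); rewrite !ffunE /= Nn => /eqP; rewrite subr_eq0 => /eqP.
  by have := H (1%g, n); rewrite !ffunE /= (negPf N'n).
apply/ffunP=> -[s n]; rewrite !ffunE /=.
by case: ifPn => [Nn | /cN //]; rewrite cG // subrr.
Qed.

Hypothesis tauM : {morph tau : s t / (s * t)%g}.
Hypothesis tauN : forall s, tau s \in 'N(N)%g.

Lemma mem_tauJ n s : ((n ^ tau s)%g \in N) = (n \in N).
Proof. by rewrite memJ_norm. Qed.

Lemma tau1 : tau 1%g = 1%g.
Proof. by apply: (mulgI (tau 1%g)); rewrite -tauM !mulg1. Qed.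

(** Here n is arbitrary: both sides vanish outside N. *)
Lemma fixed_spaceE c s n : c \in fixed_space -> c (n ^ tau s)%g = s (c n).
Proof.
case/fixed_spaceP=> cN cG; have [/cG // | N'n] := boolP (n \in N).
by rewrite !cN ?mem_tauJ // rmorph0.
Qed.

Lemma fixed_space1 : 1 \in fixed_space.
Proof.
apply/fixed_spaceP; split=> [n | s n Nn]; rewrite grpalg_1E !ffunE.
  by case: eqP => // ->; rewrite group1.
by rewrite conjg_eq1 rmorph_nat.
Qed.

Lemma fixed_spaceM c d : c \in fixed_space -> d \in fixed_space ->
  c * d \in fixed_space.
Proof.
move=> Uc Ud; have [cN _] := fixed_spaceP _ Uc; have [dN _] := fixed_spaceP _ Ud.
apply/fixed_spaceP; split=> [m N'm | s m Nm]; rewrite grpalg_mulE !ffunE.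
  apply: big1 => n _; have [Nn | /cN->] := boolP (n \in N); last by rewrite mul0r.
  by rewrite dN ?mulr0 // groupMr ?groupV.
rewrite (reindex_inj (conjg_inj (tau s))) rmorph_sum; apply: eq_bigr => n _ /=.
by rewrite rmorphM /= -!fixed_spaceE // conjMg conjVg.
Qed.

Fact fixed_space_is_aspace : is_aspace fixed_space.
Proof.
rewrite /is_aspace has_algid1 ?fixed_space1 //=.
by apply/prodvP; apply: fixed_spaceM.
Qed.
Canonical fixed_aspace := ASpace fixed_space_is_aspace.

Definition descended := subvs_of fixed_aspace.
HB.instance Definition _ := Falgebra.on descended.

Local Notation dval := (@vsval _ _ fixed_space).

Definition ev (h : descended) (n : gT) : Lt := (dval h : {ffun gT -> Lt}) n.

Lemma evP (h : descended) : dval h \in fixed_space. Proof. exact: subvsP. Qed.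

Lemma ev_linear n : linear (ev^~ n).
Proof. by move=> k h h'; rewrite /ev linearP !ffunE. Qed.

Lemma ev_sep : separating ev.
Proof. by move=> h h0; apply/val_inj/ffunP=> n; rewrite ffunE -[RHS](h0 n). Qed.

Lemma ev_inj h h' : (forall n, ev h n = ev h' n) -> h = h'.
Proof. by move=> H; apply/val_inj/ffunP=> n; apply: H. Qed.

Lemma ev_gal h s n : ev h (n ^ tau s)%g = s (ev h n).
Proof. exact: fixed_spaceE (evP h). Qed.

Lemma ev_out h n : n \notin N -> ev h n = 0.
Proof. by have [hN _] := fixed_spaceP _ (evP h); apply: hN. Qed.

Lemma ev1 n : ev 1 n = (n == 1%g)%:R.
Proof.
rewrite /ev; have /eqP -> : @vsval _ _ fixed_aspace 1 == 1.
  by rewrite [_ == _]algid_eq1 fixed_space1.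
by rewrite grpalg_1E ffunE.
Qed.

Lemma evM h h' m : ev (h * h') m = \sum_n ev h n * ev h' (m * n^-1)%g.
Proof. by rewrite /ev [dval _]grpalg_mulE ffunE. Qed.

Definition mk_descended c (Uc : c \in fixed_space) : descended := Subvs Uc.

Hypothesis galLt : galois 1 {:Lt}.

Lemma ev_free : Lt_free ev.
Proof.
apply: (fixed_Lt_free galLt ev_linear ev_sep) => s n.
exists (n ^ tau s^-1)%g => h.
by rewrite -ev_gal -conjgM -tauM mulVg tau1 conjg1.
Qed.

(** The sum of all Galois conjugates of the multiple by l of the basis element
    m. *)
Definition orbit_sum (l : Lt) (m : gT) : A :=
  [ffun n => if m \in N then \sum_(s | (m ^ tau s)%g == n) s l else 0].

Lemma orbit_sum_fixed l m : orbit_sum l m \in fixed_space.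
Proof.
apply/fixed_spaceP; rewrite /orbit_sum; split=> [n N'n | t n Nn]; rewrite !ffunE.
  case: ifP => // Nm; rewrite big_pred0 // => s.
  by apply: contraNF N'n => /eqP <-; rewrite mem_tauJ.
case: ifP => Nm; last by rewrite rmorph0.
rewrite (reindex_inj (mulIg t)) rmorph_sum /=.
apply: eq_big => [s | s _]; last by rewrite galMf.
by rewrite tauM conjgM (inj_eq (conjg_inj _)).
Qed.

Definition orbit_elt l m : descended := mk_descended (orbit_sum_fixed l m).

Lemma orbit_ev l m n :
  ev (orbit_elt l m) n = if m \in N then \sum_(s | (m ^ tau s)%g == n) s l else 0.
Proof. by rewrite /ev /orbit_elt /= ffunE. Qed.

Variables (r : nat) (d e : 'I_r -> Lt) (theta : Lt).
Hypothesis dual : forall s, \sum_i d i * s (e i) = (s == 1%g)%:R.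
Hypothesis trace_theta : trace theta = 1.

(** The orbit sums span Lt[N] over Lt: for dual families d and e, only s = 1
    contributes. *)
Lemma orbit_span m n :
  \sum_i d i * ev (orbit_elt (e i) m) n = ((m \in N) && (m == n))%:R.
Proof.
under eq_bigr do rewrite orbit_ev; case: (m \in N) => /=; last first.
  by rewrite big1 // => i _; rewrite mulr0.
under eq_bigr do rewrite mulr_sumr; rewrite exchange_big /=.
under eq_bigr do rewrite dual.
rewrite big_mkcond (bigD1 1%g) //= eqxx tau1 conjg1 big1 ?addr0 => [|s /negPf ->].
  by case: ifP.
by rewrite if_same.
Qed.

(** The values of a basis at the points of N form a matrix that is row free by
    [ev_free] and row full by [orbit_span], hence square. *)
Lemma dim_descended : \dim {:descended} = #|N|.
Proof.
pose B := \matrix_(j < \dim {:descended}, x < #|N|)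
  ev (vbasis {:descended})`_j (enum_val x).
have frB : row_free B.
  apply: inj_row_free => u uB; apply/rowP=> j; rewrite mxE.
  apply: (ev_free (l := fun j => u 0 j)) => n.
  have [Nn|N'n] := boolP (n \in N); last first.
    by rewrite big1 // => i _; rewrite ev_out ?mulr0.
  have := congr1 (fun M : 'rV_ _ => M 0 (enum_rank_in Nn n)) uB; rewrite !mxE => E.
  by rewrite -[RHS]E; apply: eq_bigr => i _; rewrite mxE enum_rankK_in.
have rowB h : ((\row_(x < #|N|) ev h (enum_val x)) <= B)%MS.
  apply/submxP; exists (\row_j (coord (vbasis {:descended}) j h)%:A).
  apply/rowP=> x; rewrite !mxE [in LHS](coord_vbasis (memvf h)).
  rewrite (linear_fun_sum _ _ (ev_linear _)); apply: eq_bigr => j _.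
  by rewrite !mxE mulr_algl.
have fuB : row_full B.
  rewrite -sub1mx; apply/row_subP=> x; rewrite rowE mulmx1.
  suff -> : delta_mx 0 x =
      \sum_i d i *: \row_y ev (orbit_elt (e i) (enum_val x)) (enum_val y).
    by apply: summx_sub => i _; apply: scalemx_sub.
  apply/rowP=> y; rewrite summxE !mxE eqxx /=.
  under eq_bigr do rewrite !mxE; rewrite orbit_span enum_valP /=.
  by rewrite (inj_eq enum_val_inj) eq_sym.
by move: frB fuB; rewrite /row_free /row_full => /eqP -> /eqP.
Qed.

Let triple : finType := (gT * 'I_r * 'I_r)%type.

(** The diagonal element, with coefficient h m at m (x) m, is rewritten in terms
    of orbit sums by [orbit_span] and then averaged over the Galois group with
    weight theta, so that its coefficients are traces and hence in K. *)
Definition dcomul (h : descended) : tensor descended descended :=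
  \sum_(x : triple)
    base_coef (trace (theta * (ev h x.1.1 * (d x.1.2 * d x.2)))) *:
      tens (orbit_elt (e x.1.2) x.1.1) (orbit_elt (e x.2) x.1.1).

Lemma trace_linear : linear (@trace K Lt).
Proof.
move=> k a b; rewrite /trace scaler_sumr -big_split; apply: eq_bigr => s _.
by rewrite linearP.
Qed.

Fact dcomul_linear : linear dcomul.
Proof.
move=> k h h'; rewrite /dcomul scaler_sumr -big_split; apply: eq_bigr => x _ /=.
rewrite scalerA -scalerDl; congr (_ *: _).
rewrite -linearP -trace_linear; congr (base_coef (trace _)).
by rewrite ev_linear mulrDl mulrDr -scalerAl -scalerAr.
Qed.
HB.instance Definition _ := GRing.isLinear.Build K descended
  (tensor descended descended) _ dcomul dcomul_linear.

Lemma ev_bilinear n n' :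
  (forall y : descended, linear (fun a : descended => ev a n * ev y n')) /\
  (forall x : descended, linear (fun b : descended => ev x n * ev b n')).
Proof.
split=> y k h h'; rewrite ev_linear.
  by rewrite mulrDl scalerAl.
by rewrite mulrDr scalerAr.
Qed.

(** The diagonal element is Galois invariant, so that averaging it with a
    weight of trace 1 does not change it. *)
Lemma ev_dcomul h n n' :
  tlift (fun a b => ev a n * ev b n') (dcomul h) = (n == n')%:R * ev h n.
Proof.
have [evl evr] := ev_bilinear n n'.
rewrite /dcomul (linear_fun_sum _ _ (tlift_is_linear _)).
transitivity (\sum_(s : gal_of {:Lt}) s theta * ((n == n')%:R * ev h n)); last first.
  by rewrite -mulr_suml -/(trace theta) trace_theta mul1r.
pose term (s : gal_of {:Lt}) (x : triple) :=
  s (theta * (ev h x.1.1 * (d x.1.2 * d x.2))) *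
  (ev (orbit_elt (e x.1.2) x.1.1) n * ev (orbit_elt (e x.2) x.1.1) n').
transitivity (\sum_s \sum_(x : triple) term s x).
  rewrite exchange_big; apply: eq_bigr => x _ /=.
  by rewrite tlift_tens // -mulr_suml -[_ *: _]mulr_algl trace_base.
apply: eq_bigr => s _.
have preJ m : exists m0, m = (m0 ^ tau s)%g.
  by exists (m ^ (tau s)^-1)%g; rewrite conjgKV.
have [[n0 En] [n0' En']] := (preJ n, preJ n').
rewrite {}/term {}En {}En' (inj_eq (conjg_inj _)) ev_gal.
transitivity (s (theta * \sum_m ev h m *
   ((\sum_i d i * ev (orbit_elt (e i) m) n0) *
    (\sum_i d i * ev (orbit_elt (e i) m) n0')))).
  transitivity (s (\sum_(x : triple) theta * (ev h x.1.1 * (d x.1.2 * d x.2)) *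
      (ev (orbit_elt (e x.1.2) x.1.1) n0 * ev (orbit_elt (e x.2) x.1.1) n0'))).
    by rewrite rmorph_sum; apply: eq_bigr => x _; rewrite !ev_gal !rmorphM.
  congr (s _); rewrite mulr_sumr.
  rewrite -(pair_bigA _ (fun (mi : gT * 'I_r) j =>
      theta * (ev h mi.1 * (d mi.2 * d j)) *
      (ev (orbit_elt (e mi.2) mi.1) n0 * ev (orbit_elt (e j) mi.1) n0'))) /=.
  rewrite -(pair_bigA _ (fun m i => \sum_j theta * (ev h m * (d i * d j)) *
      (ev (orbit_elt (e i) m) n0 * ev (orbit_elt (e j) m) n0'))) /=.
  apply: eq_bigr => m _; rewrite mulr_suml !mulr_sumr; apply: eq_bigr => i _.
  rewrite !mulr_sumr; apply: eq_bigr => j _.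
  by rewrite -!mulrA; do 3!congr (_ * _); rewrite mulrCA.
rewrite rmorphM; congr (_ * _).
transitivity (s ((n0 == n0')%:R * ev h n0)); last by rewrite rmorphM rmorph_nat.
congr (s _); under eq_bigr do rewrite !orbit_span.
rewrite (bigD1 n0) //= big1 ?addr0 => [|m /negPf n0m].
  rewrite eqxx andbT; have [Nn0|/ev_out->] := boolP (n0 \in N).
    by rewrite /= mul1r mulrC.
  by rewrite mul0r mulr0.
by rewrite n0m andbF mul0r mulr0.
Qed.

Lemma ev_tlift (U V : vectType K) (f : U -> V -> descended) (t : tensor U V) n :
  ev (tlift f t) n = tlift (fun a b => ev (f a b) n) t.
Proof. by rewrite (tlift_morph (g := ev^~ n) f t (ev_linear n)). Qed.

Lemma dcomul_injP (W : vectType K) (J : Type) (psi : W -> J -> Lt)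
    (t t' : tensor descended W) :
    separating psi -> (forall j, linear (psi^~ j)) ->
    (forall n j, tlift (fun a b => ev a n * psi b j) t =
                 tlift (fun a b => ev a n * psi b j) t') ->
  t = t'.
Proof.
by move=> sep_psi lin_psi H; apply: tlift_eval_inj H; first exact: ev_free.
Qed.

Fact dcomul1 : dcomul 1 = tens 1 1.
Proof.
apply: (dcomul_injP ev_sep ev_linear) => n n'; have [evl evr] := ev_bilinear n n'.
rewrite ev_dcomul tlift_tens // !ev1 -!natrM !mulnb.
have [->|nn'] := eqVneq n n'; first by rewrite andbb.
by have [n1|//] := eqVneq n 1%g; rewrite n1 eq_sym in nn'; rewrite (negPf nn').
Qed.

(** Through [ev_dcomul], every Sweedler sum of products of values becomes a sum
    over the diagonal. All the Hopf axioms below are obtained in this way, after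
    evaluation. *)
Lemma dcomul_sum (C : gT -> gT -> Lt) h :
  tlift (fun a b => \sum_n \sum_n' C n n' * (ev a n * ev b n')) (dcomul h) =
  \sum_n C n n * ev h n.
Proof.
rewrite tlift_sum; apply: eq_bigr => n _; rewrite tlift_sum (bigD1 n) //=.
rewrite tlift_mull ev_dcomul eqxx mul1r big1 ?addr0 // => n' n'n.
by rewrite tlift_mull ev_dcomul eq_sym (negPf n'n) mul0r mulr0.
Qed.

Fact dcomulM x y : dcomul (x * y) = tmul (dcomul x) (dcomul y).
Proof.
apply: (dcomul_injP ev_sep ev_linear) => m m'; have [evl evr] := ev_bilinear m m'.
have lin_mm : linear (tlift (fun a b : descended => ev a m * ev b m')).
  exact: tlift_is_linear.
rewrite ev_dcomul /tmul (tlift_morph _ _ lin_mm).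
transitivity (tlift (fun a b => \sum_n \sum_n' ((m * n^-1 == m' * n'^-1)%g%:R *
    ev y (m * n^-1)%g) * (ev a n * ev b n')) (dcomul x)).
  rewrite dcomul_sum evM mulr_sumr; apply: eq_bigr => n _.
  by rewrite (inj_eq (mulIg _)) mulrAC mulrA.
apply: eq_tlift => a b; rewrite (tlift_morph _ _ lin_mm).
transitivity (tlift (fun u u' => \sum_n \sum_n' (ev a n * ev b n') *
    (ev u (m * n^-1)%g * ev u' (m' * n'^-1)%g)) (dcomul y)).
  rewrite tlift_sum; apply: eq_bigr => n _.
  rewrite tlift_sum; apply: eq_bigr => n' _.
  by rewrite tlift_mull ev_dcomul mulrC.
apply: eq_tlift => u u'; rewrite tlift_tens // !evM mulr_suml.
apply: eq_bigr => n _.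
by rewrite mulr_sumr; apply: eq_bigr => n' _; rewrite mulrACA.
Qed.

Definition dcounit (h : descended) : K^o := base_coef (\sum_n ev h n).

Fact dcounit_linear : linear dcounit.
Proof.
move=> k h h'; rewrite /dcounit.
transitivity (base_coef (k *: (\sum_n ev h n) + \sum_n ev h' n)); last first.
  exact: base_coef_linear.
apply: (congr1 (@base_coef K Lt)); rewrite scaler_sumr -big_split.
apply: eq_bigr => n _.
by rewrite ev_linear.
Qed.
HB.instance Definition _ :=
  GRing.isLinear.Build K descended K^o _ dcounit dcounit_linear.

Lemma dcounitE h : (dcounit h : K)%:A = \sum_n ev h n.
Proof.
rewrite /dcounit base_coefK //; apply: (gal_fixed_base galLt) => s.
rewrite rmorph_sum [RHS](reindex_inj (conjg_inj (tau s))) /=.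
by apply: eq_bigr => n _; rewrite ev_gal.
Qed.

Lemma alg_inj (k k' : K) : k%:A = k'%:A :> Lt -> k = k'.
Proof. exact: (fmorph_inj (in_alg Lt)). Qed.

Fact dcounit1 : dcounit 1 = 1.
Proof.
apply: alg_inj; rewrite dcounitE scale1r (bigD1 1%g) //= ev1 eqxx big1 ?addr0 //.
by move=> n /negPf n1; rewrite ev1 n1.
Qed.

Fact dcounitM x y : dcounit (x * y) = dcounit x * dcounit y.
Proof.
apply: alg_inj; transitivity ((dcounit x : K)%:A * (dcounit y : K)%:A : Lt).
  rewrite !dcounitE mulr_suml; under eq_bigr do rewrite evM.
  rewrite exchange_big; apply: eq_bigr => n _ /=; rewrite mulr_sumr.
  rewrite (reindex_inj (mulIg n)) /=; apply: eq_bigr => m _.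
  by rewrite mulgK.
by rewrite mulr_algl scalerA.
Qed.

Lemma dantipode_fixed (h : descended) :
  ([ffun n => ev h n^-1%g] : A) \in fixed_space.
Proof.
apply/fixed_spaceP; split=> [n N'n | s n Nn]; rewrite !ffunE.
  by rewrite ev_out ?groupV.
by rewrite -conjVg ev_gal.
Qed.

Definition dantipode (h : descended) : descended := mk_descended (dantipode_fixed h).

Lemma ev_dantipode h n : ev (dantipode h) n = ev h n^-1%g.
Proof. by rewrite /ev /dantipode /= ffunE. Qed.

Fact dantipode_linear : linear dantipode.
Proof.
by move=> k h h'; apply: ev_inj => n; rewrite ev_linear !ev_dantipode ev_linear.
Qed.
HB.instance Definition _ := GRing.isLinear.Build K descended descended _
  dantipode dantipode_linear.

Definition ev2 (t : tensor descended descended) (x : gT * gT) : Lt :=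
  tlift (fun a b => ev a x.1 * ev b x.2) t.

Lemma ev2_linear x : linear (ev2^~ x).
Proof. exact: tlift_is_linear. Qed.

Lemma ev2_sep : separating ev2.
Proof.
move=> t t0; apply: (dcomul_injP ev_sep ev_linear) => n n'.
by rewrite [LHS](t0 (n, n')) linear_fun0 //; apply: tlift_is_linear.
Qed.

Lemma ev2_tens a b x : ev2 (tens a b) x = ev a x.1 * ev b x.2.
Proof. by have [evl evr] := ev_bilinear x.1 x.2; rewrite /ev2 tlift_tens. Qed.

Lemma ev_ev2_bilinear n x :
  (forall w, linear (fun a : descended => ev a n * ev2 w x)) /\
  (forall a, linear (fun t : tensor descended descended => ev a n * ev2 t x)).
Proof.
split=> y k h h'; first by rewrite ev_linear mulrDl scalerAl.
by rewrite ev2_linear mulrDr scalerAr.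
Qed.

Fact dcomulA h :
  tlift (fun a b => tlift (fun a1 a2 => tens a1 (tens a2 b)) (dcomul a)) (dcomul h)
  = tlift (fun a b => tens a (dcomul b)) (dcomul h).
Proof.
apply: (dcomul_injP ev2_sep ev2_linear) => n x.
have [l1 l2] := ev_ev2_bilinear n x.
have lin_nx : linear (tlift (fun (a : descended) w => ev a n * ev2 w x)).
  exact: tlift_is_linear.
rewrite !(tlift_morph _ _ lin_nx).
transitivity ((n == x.1)%:R * ((n == x.2)%:R * ev h n)).
  rewrite -ev_dcomul -tlift_mull; apply: eq_tlift => a b.
  rewrite (tlift_morph _ _ lin_nx) mulrA -ev_dcomul -tlift_mulr.
  by apply: eq_tlift => a1 a2; rewrite tlift_tens // ev2_tens mulrA.
transitivity ((x.1 == x.2)%:R * ((n == x.1)%:R * ev h n)).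
  by case: (n =P x.1) => [->|]; rewrite ?mul1r ?mul0r ?mulr0.
rewrite -ev_dcomul -tlift_mull; apply: eq_tlift => a b.
by rewrite tlift_tens // /ev2 ev_dcomul mulrCA.
Qed.

Fact dcounitl h : tlift (fun a b => (dcounit a : K) *: b) (dcomul h) = h.
Proof.
apply: ev_inj => n; rewrite ev_tlift.
transitivity (tlift (fun a b => \sum_m ev a m * ev b n) (dcomul h)).
  apply: eq_tlift => a b; rewrite (linear_funZ (ev_linear n)).
  by rewrite -mulr_suml -dcounitE mulr_algl.
rewrite tlift_sum (bigD1 n) //= ev_dcomul eqxx mul1r big1 ?addr0 // => m /negPf mn.
by rewrite ev_dcomul mn mul0r.
Qed.

Fact dcounitr h : tlift (fun a b => (dcounit b : K) *: a) (dcomul h) = h.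
Proof.
apply: ev_inj => n; rewrite ev_tlift.
transitivity (tlift (fun a b => \sum_m ev a n * ev b m) (dcomul h)).
  apply: eq_tlift => a b; rewrite (linear_funZ (ev_linear n)).
  by rewrite -mulr_sumr -dcounitE mulr_algr.
rewrite tlift_sum (bigD1 n) //= ev_dcomul eqxx mul1r big1 ?addr0 // => m /negPf mn.
by rewrite ev_dcomul eq_sym mn mul0r.
Qed.

Lemma ev_alg k n : ev (k%:A) n = (n == 1%g)%:R * k%:A.
Proof. by rewrite (linear_funZ (ev_linear n)) ev1 mulr_algr. Qed.

Fact dantipodel h :
  tlift (fun a b => dantipode a * b) (dcomul h) = (dcounit h : K)%:A.
Proof.
apply: ev_inj => m; rewrite ev_tlift ev_alg dcounitE.
transitivity (tlift (fun a b => \sum_n ev a n^-1%g * ev b (m * n^-1)%g) (dcomul h)).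
  apply: eq_tlift => a b; rewrite evM; apply: eq_bigr => n _.
  by rewrite ev_dantipode.
rewrite tlift_sum mulr_sumr (reindex_inj invg_inj) /=; apply: eq_bigr => n _.
rewrite ev_dcomul invgK; congr (_%:R * _).
by rewrite eq_sym -{2}(mul1g n) (inj_eq (mulIg n)).
Qed.

Fact dantipoder h :
  tlift (fun a b => a * dantipode b) (dcomul h) = (dcounit h : K)%:A.
Proof.
apply: ev_inj => m; rewrite ev_tlift ev_alg dcounitE.
transitivity (tlift (fun a b => \sum_n ev a n * ev b (m * n^-1)^-1%g) (dcomul h)).
  apply: eq_tlift => a b; rewrite evM; apply: eq_bigr => n _.
  by rewrite ev_dantipode.
rewrite tlift_sum mulr_sumr; apply: eq_bigr => n _.
rewrite ev_dcomul invMg invgK; congr (_%:R * _).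
by rewrite eq_sym -{2}(mulg1 n) (inj_eq (mulgI n)) eq_invg1.
Qed.

Fact dcomulC h : tlift (fun a b => tens b a) (dcomul h) = dcomul h.
Proof.
apply: (dcomul_injP ev_sep ev_linear) => n n'; have [evl evr] := ev_bilinear n n'.
have lin_nn : linear (tlift (fun a b : descended => ev a n * ev b n')).
  exact: tlift_is_linear.
rewrite (tlift_morph _ _ lin_nn) ev_dcomul.
transitivity (tlift (fun a b => ev a n' * ev b n) (dcomul h)).
  by apply: eq_tlift => a b; rewrite tlift_tens // mulrC.
by rewrite ev_dcomul eq_sym; case: eqP => [->|_] //; rewrite !mul0r.
Qed.

Definition descended_hopf : cocommHopf K :=
  CocommHopf dcomul1 dcomulM dcounit1 dcounitM dcomulA dcounitl dcounitr
    dantipodel dantipoder dcomulC.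

End Descended.

(** * Galois action on cosets and embeddings *)

Section Cosets.

Variables (K : fieldType) (Lt : splittingFieldType K) (L : {subfield Lt}).
Local Notation G' := ('Gal({:Lt} / L) : {set gal_of {:Lt}}).
Local Notation S := (gal_cosets L).
Local Notation lam := (gal_lambda L).
Implicit Types (s t : gal_of {:Lt}) (X : {set gal_of {:Lt}}) (x : Lt).

Lemma gal_cosetsP X : reflect (exists s, X = (G' :* s)%g) (X \in S).
Proof.
apply: (iffP rcosetsP) => [[s _ ->] | [s ->]]; first by exists s.
by exists s; rewrite ?mem_gal.
Qed.

Lemma base_coset : G' \in S.
Proof. by apply/gal_cosetsP; exists 1%g; rewrite mulg1. Qed.

Lemma actperm_stable s : actperm 'Rs s \in 'N(S | 'P).
Proof.
apply/astabsP=> X; rewrite /= apermE actpermE /=.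
apply/gal_cosetsP/gal_cosetsP => [[t Et] | [t ->]].
  by exists (t * s^-1)%g; rewrite rcosetM -Et rcosetE -rcosetM mulgV mulg1.
by exists (t * s)%g; rewrite rcosetE rcosetM.
Qed.

Lemma gal_lambdaE s X : X \in S -> lam s X = (X :* s)%g.
Proof.
by move=> SX; rewrite /gal_lambda restr_permE ?actperm_stable // actpermE /= rcosetE.
Qed.

Lemma gal_lambdaM : {morph lam : s t / (s * t)%g}.
Proof.
move=> s t; rewrite /gal_lambda -morphM ?actperm_stable //.
by rewrite -morphM ?inE.
Qed.

Lemma gal_lambda1 : lam 1%g = 1%g.
Proof. by apply: (mulgI (lam 1%g)); rewrite -gal_lambdaM !mulg1. Qed.

Lemma gal_lambda_Sym s : lam s \in perm.Sym S.
Proof. by rewrite inE restr_perm_on. Qed.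

Lemma gal_lambda_coset s t : lam s (G' :* t)%g = (G' :* (t * s))%g.
Proof. by rewrite gal_lambdaE ?rcosetM //; apply/gal_cosetsP; exists t. Qed.

Lemma fix_L t x : t \in G' -> x \in L -> t x = x.
Proof. by move=> Gt Lx; apply: fixed_gal Gt Lx; apply: subvf. Qed.

Lemma mem_coset_eq X s t x : X \in S -> s \in X -> t \in X -> x \in L -> s x = t x.
Proof.
case/gal_cosetsP=> g -> /rcosetP[s1 Gs1 ->] /rcosetP[t1 Gt1 ->] Lx.
by rewrite !galMf (fix_L Gs1 Lx) (fix_L Gt1 Lx).
Qed.

Lemma repr_coset X : X \in S -> repr X \in X.
Proof. by case/gal_cosetsP=> g ->; apply: mem_repr_rcoset. Qed.

Lemma repr_rcosetE s x : x \in L -> repr (G' :* s)%g x = s x.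
Proof.
have SX : (G' :* s)%g \in S by apply/gal_cosetsP; exists s.
move=> Lx; apply: (mem_coset_eq SX) => //; first exact: repr_coset.
exact: rcoset_refl.
Qed.

Lemma repr_gal_lambda s X x : X \in S -> x \in L -> repr (lam s X) x = s (repr X x).
Proof.
case/gal_cosetsP=> g -> Lx.
by rewrite gal_lambda_coset !repr_rcosetE // galMf.
Qed.

Lemma coset_repr X : X \in S -> X = lam (repr X) G'.
Proof.
move=> SX; have XX := repr_coset SX.
case/gal_cosetsP: SX XX => g -> gX.
by rewrite gal_lambdaE ?base_coset //; apply/rcoset_eqP; rewrite rcoset_sym.
Qed.

Lemma gal_lambda_base t : t \in G' -> lam t G' = G'.
Proof. by move=> Gt; rewrite gal_lambdaE ?base_coset // rcoset_id. Qed.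

Hypothesis galLt : galois 1 {:Lt}.

Lemma galL : galois L {:Lt}.
Proof. by apply: galoisS galLt; rewrite sub1v subvf. Qed.

(** Apply the relation to the trace in L of an arbitrary element of Lt: it
    becomes a relation between the automorphisms of Lt. *)
Lemma coset_indep (c : {set gal_of {:Lt}} -> Lt) :
    (forall x, x \in L -> \sum_(X in S) c X * repr X x = 0) ->
  forall X, X \in S -> c X = 0.
Proof.
move=> H X SX.
suff H2 : forall a, \sum_(s : gal_of {:Lt}) c (G' :* s)%g * s a = 0.
  by case/gal_cosetsP: SX => s ->; apply: (gal_indep (c := fun s => c (G' :* s)%g) H2).
move=> a; have LTr : galTrace L {:Lt} a \in L by rewrite mem_galTrace ?memvf ?galL.
rewrite -[RHS](H _ LTr).
rewrite (partition_big (fun s => (G' :* s)%g) (mem S)) /=; last first.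
  by move=> s _; apply/gal_cosetsP; exists s.
apply: eq_bigr => Y /gal_cosetsP[g ->]; rewrite repr_rcosetE // rmorph_sum mulr_sumr.
rewrite (reindex_inj (mulIg g)) /=.
apply: eq_big => [s | s /eqP ->]; last by rewrite galMf.
by apply/eqP/idP => [/rcoset_eqP | Gs]; [|apply/rcoset_eqP];
  rewrite mem_rcoset mulgK.
Qed.

Lemma card_cosets : #|S| = \dim L.
Proof.
have := dim_fixed_galois galLt (_ : 'Gal({:Lt} / L)%G \subset 'Gal({:Lt} / 1)).
have fL : fixedField 'Gal({:Lt} / L) = L by apply/galois_fixedField; exact: galL.
rewrite /= fL dimv1 divn1 => -> //.
by rewrite gal_setT subsetT.
Qed.

Hypothesis closL : is_normal_closure L.

(** The kernel is a normal subgroup of Galois contained in G', so that its fixed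
    field is normal over K and contains L: it is Lt. *)
Lemma gal_lambda_inj : injective lam.
Proof.
pose D := [set s | lam s == 1%g].
have gD : group_set D.
  apply/group_setP; split=> [|s t]; rewrite !inE.
    by rewrite gal_lambda1.
  by move=> /eqP s1 /eqP t1; rewrite gal_lambdaM s1 t1 mulg1.
pose DG := Group gD.
have nD : DG <| 'Gal({:Lt} / 1).
  rewrite gal_setT /normal subsetT; apply/subsetP=> t _; rewrite inE.
  apply/subsetP=> _ /imsetP[s Ds ->]; move: Ds; rewrite !inE => /eqP s1.
  apply/eqP; rewrite conjgE !gal_lambdaM s1 mul1g -gal_lambdaM mulVg.
  exact: gal_lambda1.
have sDG' : DG \subset G'.
  apply/subsetP=> s; rewrite inE => /eqP s1.
  have := gal_lambda_coset s 1%g; rewrite s1 perm1 mul1g mulg1 => ->.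
  exact: rcoset_refl.
have LD : (L <= fixedField DG)%VS.
  by rewrite -galois_connection ?subvf.
have := normal_fixedField_galois galLt nD; case/and3P=> _ _ nfD.
have Dfull : (fixedField DG : {vspace Lt}) = {:Lt}%VS.
  exact: (closL (M := [aspace of fixedField DG]) LD nfD).
have D1 s : s \in DG -> s = 1%g.
  move=> Ds; apply/eqP/gal_eqP=> a _; rewrite gal_id.
  have : a \in fixedField DG by rewrite Dfull memvf.
  by case/mem_fixedFieldP=> _; apply.
move=> s t st; apply/eqP; rewrite eq_mulgV1; apply/eqP/D1.
rewrite inE gal_lambdaM st -gal_lambdaM mulgV.
by rewrite gal_lambda1.
Qed.

End Cosets.

(** * The Hopf Galois structure of a regular subgroup *)

Section Regular.

Variables (K : fieldType) (Lt : splittingFieldType K) (L : {subfield Lt}).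
Variable N : {group {perm {set gal_of {:Lt}}}}.
Hypothesis galLt : galois 1 {:Lt}.
Hypothesis regN : regular_on (gal_cosets L) N.
Local Notation G' := ('Gal({:Lt} / L) : {set gal_of {:Lt}}).
Local Notation S := (gal_cosets L).
Local Notation lam := (gal_lambda L).
Implicit Types (n m : {perm {set gal_of {:Lt}}}) (x y : Lt).

Definition emb_coset n : {set gal_of {:Lt}} := (n^-1)%g G'.
(** Used for x in L, where all the elements of the coset agree. *)
Definition embed n (x : Lt) : Lt := repr (emb_coset n) x.

Lemma mem_emb_coset n : n \in N -> emb_coset n \in S.
Proof.
move=> Nn; rewrite /emb_coset; case: regN => /subsetP sNS _ _.
have : n^-1%g \in perm.Sym S by rewrite sNS ?groupV.
by rewrite inE => /perm_closed ->; apply: base_coset.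
Qed.

Lemma emb_coset_inj : {in N &, injective emb_coset}.
Proof.
move=> n m Nn Nm E; apply: invg_inj; case: regN => _ _ reg1.
apply/eqP; rewrite eq_mulgV1; apply/eqP/set1P.
rewrite -[[set 1%g]](reg1 _ (base_coset L)) inE groupM ?groupV //.
by apply/astab1P; rewrite /= apermE permM -/(emb_coset n) E permK.
Qed.

Lemma emb_coset_surj X : X \in S -> exists2 n, n \in N & emb_coset n = X.
Proof.
move=> SX; case: regN => _ trN _.
have [n Nn ->] := atransP2 trN (base_coset L) SX.
by exists n^-1%g; rewrite ?groupV // /emb_coset invgK.
Qed.

Lemma im_emb_coset : emb_coset @: N = S.
Proof.
apply/setP=> X; apply/imsetP/idP => [[n Nn ->]|]; first exact: mem_emb_coset.
by case/emb_coset_surj=> n Nn <-; exists n.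
Qed.

Lemma embed_indep (c : {perm {set gal_of {:Lt}}} -> Lt) :
    (forall x, x \in L -> \sum_(n in N) c n * embed n x = 0) ->
  forall n, n \in N -> c n = 0.
Proof.
move=> H.
pose c' X := c (odflt 1%g [pick n in N | emb_coset n == X]).
have c'E n : n \in N -> c' (emb_coset n) = c n.
  move=> Nn; rewrite /c'; case: pickP => [m /andP[Nm /eqP E] | /(_ n)] /=.
    by rewrite (emb_coset_inj Nm Nn E).
  by rewrite Nn eqxx.
move=> n Nn; rewrite -c'E //; apply: (coset_indep galLt) (mem_emb_coset Nn) => x Lx.
rewrite -[RHS](H x Lx) -im_emb_coset big_imset /=; last exact: emb_coset_inj.
by apply: eq_bigr => m Nm; rewrite c'E.
Qed.

Lemma card_regular : #|N| = \dim L.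
Proof.
rewrite -(card_cosets L galLt) -im_emb_coset card_in_imset //.
exact: emb_coset_inj.
Qed.

Lemma embedM n x y : embed n (x * y) = embed n x * embed n y.
Proof. exact: rmorphM. Qed.

Lemma embed1 n : embed n 1 = 1.
Proof. exact: rmorph1. Qed.

Lemma emb_coset_conj n s : (n ^ lam s)%g^-1%g (lam s G') = lam s (emb_coset n).
Proof. by rewrite -conjVg permJ. Qed.

Lemma embed_stab t n x : t \in G' -> n \in N -> x \in L ->
  t (embed n x) = embed (n ^ lam t)%g x.
Proof.
move=> Gt Nn Lx; rewrite /embed -(repr_gal_lambda t (mem_emb_coset Nn) Lx).
rewrite -emb_coset_conj.
by rewrite /emb_coset gal_lambda_base.
Qed.

(** The conjugate of m appearing here is the one at which Galois moves the
    coefficient of m in [ev_gal]; this is why convolution of coefficients becomes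
    composition of the actions on L. *)
Lemma embed_comp n m x : n \in N -> m \in N -> x \in L ->
  repr (emb_coset n) (embed m x) = embed (m ^ lam (repr (emb_coset n)) * n)%g x.
Proof.
move=> Nn Nm Lx; rewrite /embed -(repr_gal_lambda _ (mem_emb_coset Nm) Lx).
congr (gal_repr (repr _) x).
rewrite -emb_coset_conj -(coset_repr (mem_emb_coset Nn)) /emb_coset.
by rewrite [in RHS]invMg permM.
Qed.

Hypothesis nNG : normalized_by_gal L N.

Lemma gal_lambda_norm s : lam s \in 'N(N)%g.
Proof. by apply: (subsetP nNG); apply: imset_f; apply: mem_gal. Qed.

Local Notation H := (descended gal_lambda_norm).

Definition act_val (h : H) (x : Lt) : Lt := \sum_n ev h n * embed n x.

Lemma act_valN h x : act_val h x = \sum_(n in N) ev h n * embed n x.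
Proof.
rewrite [RHS]big_mkcond; apply: eq_bigr => n _.
by case: ifPn => // N'n; rewrite ev_out ?mul0r.
Qed.

(** An automorphism over L permutes the terms of the sum. *)
Lemma act_val_L h x : x \in L -> act_val h x \in L.
Proof.
move=> Lx; have /galois_fixedField <- := galL L galLt.
apply/fixedFieldP=> [|t Gt]; first exact: memvf.
rewrite !act_valN rmorph_sum [RHS](reindex_inj (conjg_inj (lam t))) /=.
apply: eq_big => [n | n Nn]; first by rewrite (mem_tauJ gal_lambda_norm).
by rewrite rmorphM /= -ev_gal embed_stab.
Qed.

Definition act_fun (h : H) (x : subvs_of L) : subvs_of L :=
  vsproj L (act_val h (vsval x)).

Lemma act_funE h (x : subvs_of L) : vsval (act_fun h x) = act_val h (vsval x).
Proof. by rewrite /act_fun vsprojK // act_val_L // subvsP. Qed.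

Fact act_fun_linear h : linear (act_fun h).
Proof.
move=> k x y; apply: val_inj; rewrite [RHS]linearP /= !act_funE /act_val.
rewrite scaler_sumr -big_split; apply: eq_bigr => n _ /=.
by rewrite /embed !linearP /= mulrDr scalerAr.
Qed.
HB.instance Definition _ h :=
  GRing.isLinear.Build K (subvs_of L) (subvs_of L) _ (act_fun h) (act_fun_linear h).

Definition dact (h : H) : 'End(subvs_of L) := linfun (act_fun h).

Lemma dactE h (x : subvs_of L) : vsval (dact h x) = act_val h (vsval x).
Proof. by rewrite lfunE /= act_funE. Qed.

Fact dact_linear : linear dact.
Proof.
move=> k h h'; apply/lfunP=> x; rewrite !lfunE /= !lfunE; apply: val_inj.
rewrite [RHS]linearP /= dactE !act_funE /act_val scaler_sumr -big_split.
by apply: eq_bigr => n _ /=; rewrite ev_linear mulrDl scalerAl.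
Qed.
HB.instance Definition _ :=
  GRing.isLinear.Build K H 'End(subvs_of L) _ dact dact_linear.

Variables (r : nat) (d e : 'I_r -> Lt) (theta : Lt).
Hypothesis dual : forall s : gal_of {:Lt}, \sum_i d i * s (e i) = (s == 1%g)%:R.
Hypothesis trace_theta : trace theta = 1.

Local Notation dcomul := (dcomul (tauN := gal_lambda_norm) (gal_lambdaM L) d e theta).

Definition dhopf : cocommHopf K :=
  descended_hopf (gal_lambdaM L) gal_lambda_norm galLt dual trace_theta.

Fact dact1 (x : subvs_of L) : dact 1 x = x.
Proof.
apply: val_inj; rewrite /= dactE /act_val (bigD1 1%g) //= ev1 eqxx mul1r.
rewrite big1 ?addr0 => [|n /negPf n1]; last by rewrite ev1 n1 mul0r.
rewrite /embed /emb_coset invg1 perm1 (fix_L _ (subvsP x)) //.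
exact: mem_repr (group1 _).
Qed.

Fact dactM (h k : H) (x : subvs_of L) : dact (h * k) x = dact h (dact k x).
Proof.
apply: val_inj; rewrite /= !dactE; set v := vsval x; have Lv : v \in L := subvsP x.
rewrite /act_val; under eq_bigr do rewrite evM mulr_suml.
rewrite exchange_big; apply: eq_bigr => n _ /=.
have [Nn|N'n] := boolP (n \in N); last first.
  by rewrite (ev_out h N'n) mul0r big1 // => m _; rewrite !mul0r.
rewrite [embed n _]rmorph_sum mulr_sumr /=.
pose rn := repr (emb_coset n).
rewrite (reindex_inj (mulIg n)) (reindex_inj (conjg_inj (lam rn))) /=.
apply: eq_bigr => m _; rewrite mulgK rmorphM /= -ev_gal -/rn -mulrA.
have [Nm|N'm] := boolP (m \in N); first by rewrite embed_comp.
rewrite (ev_out k (_ : (m ^ lam rn)%g \notin N)) ?mul0r //.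
by rewrite (mem_tauJ gal_lambda_norm).
Qed.

Fact dact_one (h : H) : dact h 1 = (dcounit h : K)%:A.
Proof.
apply: val_inj; rewrite /= dactE /= algid1.
apply: (etrans _ (esym (dcounitE galLt h))).
by rewrite /act_val; apply: eq_bigr => n _; rewrite embed1 mulr1.
Qed.

Fact dact_mul (h : H) (x y : subvs_of L) :
  dact h (x * y) = tlift (fun a b => dact a x * dact b y) (dcomul h).
Proof.
apply: val_inj; rewrite /= dactE (tlift_morph (g := vsval)); last first.
  by move=> k u v; rewrite linearP.
transitivity (tlift (fun a b : H => \sum_n \sum_n'
    (embed n (vsval x) * embed n' (vsval y)) * (ev a n * ev b n')) (dcomul h)).
  rewrite (dcomul_sum (gal_lambdaM L) galLt dual trace_theta); apply: eq_bigr => n _.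
  by rewrite rmorphM embedM mulrC.
apply: eq_tlift => a b; rewrite rmorphM /= !dactE /act_val mulr_suml.
apply: eq_bigr => n _; rewrite mulr_sumr; apply: eq_bigr => m _.
by rewrite mulrC mulrACA.
Qed.

Lemma vsval_separating : separating (fun (x : subvs_of L) (_ : unit) => vsval x).
Proof. by move=> x /(_ tt) x0; apply: val_inj; rewrite /= x0. Qed.

(** An element of the kernel has all its coefficients zero by Dedekind, then is
    zero by [ev_free]; and both spaces have dimension the square of that of L. *)
Fact dact_bij : bijective
  (tlift (fun (x : subvs_of L) (h : H) => (amull x \o dact h)%VF)).
Proof.
set Theta := tlift _.
have Tl : linear Theta by exact: tlift_is_linear.
pose M := GRing.isLinear.Build K (tensor (subvs_of L) H) 'End(subvs_of L) _ Theta Tl.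
pose TL : {linear tensor (subvs_of L) H -> 'End(subvs_of L)} := HB.pack Theta M.
pose f : 'Hom(tensor (subvs_of L) H, 'End(subvs_of L)) := linfun TL.
have fE t : f t = Theta t by rewrite lfunE.
have ker_f : lker f == 0%VS.
  rewrite -subv0; apply/subvP=> t; rewrite memv_ker memv0 fE => /eqP t0.
  apply/eqP; apply: (tlift_eval_injr (phi := fun (x : subvs_of L) (_ : unit) => vsval x)
    (psi := @ev _ _ _ N lam gal_lambda_norm)).
  - exact: vsval_separating.
  - by move=> _ k u v; rewrite linearP.
  - exact: (ev_free (gal_lambdaM L) galLt).
  move=> _ n; rewrite [RHS](linear_fun0 (tlift_is_linear _)).
  have [Nn|N'n] := boolP (n \in N); last first.
    by apply: big1 => i _; apply: big1 => j _; rewrite ev_out // mulr0 scaler0.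
  pose c n := tlift (fun (a : subvs_of L) (b : H) => vsval a * ev b n) t.
  apply: (embed_indep (c := c)) => //.
  move=> x Lx; have := congr1 (fun g : 'End(subvs_of L) => vsval (g (Subvs Lx))) t0.
  rewrite zero_lfunE [X in _ = X]linear0 => E0; rewrite -[RHS]E0 {E0}.
  rewrite (tlift_morph
    (g := fun g : 'End(subvs_of L) => vsval (g (Subvs Lx)))); last first.
    by move=> k u v; rewrite add_lfunE scale_lfunE linearP.
  transitivity (tlift (fun (a : subvs_of L) (b : H) =>
    \sum_(n in N) vsval a * ev b n * embed n x) t).
    by rewrite tlift_sum; apply: eq_bigr => m _; rewrite tlift_mulr.
  apply: eq_tlift => a b; rewrite comp_lfunE [amull _ _]lfunE /= dactE act_valN mulr_sumr.
  by apply: eq_bigr => m _; rewrite mulrA.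
have im_f : limg f = fullv.
  apply/eqP; rewrite eqEdim subvf limg_dim_eq ?(eqP ker_f) ?capv0 //.
  have -> : \dim {:'End(subvs_of L)} = (\dim L * \dim L)%N by rewrite dimvf.
  have -> : \dim {:tensor (subvs_of L) H} = (\dim {:subvs_of L} * \dim {:H})%N.
    by rewrite dimvf.
  have -> : \dim {:subvs_of L} = \dim L by rewrite dimvf.
  by rewrite (dim_descended (gal_lambdaM L) gal_lambda_norm galLt dual) card_regular /=.
exists (f^-1)%VF => u; rewrite -fE; first exact: lker0_lfunK.
by rewrite limg_lfunVK // im_f memvf.
Qed.

Definition gp_structure : hopfGalois (subvs_of L) :=
  @HopfGalois K (subvs_of L) dhopf dact dact1 dactM dact_one dact_mul dact_bij.

Definition coeff_map (h : gp_structure) :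
  {ffun {perm {set gal_of {:Lt}}} -> Lt} := @vsval _ _ (fixed_space N lam) h.

Fact coeff_map_linear : linear coeff_map.
Proof. by move=> k h h'; rewrite /coeff_map linearP. Qed.

HB.instance Definition _ := GRing.isLinear.Build K gp_structure
  {ffun {perm {set gal_of {:Lt}}} -> Lt} _ coeff_map coeff_map_linear.

Lemma gp_structure_corresponds : gp_corresponds gp_structure N.
Proof.
exists coeff_map; split.
- split=> [h h' /val_inj // | c]; split=> [[h <-] | [cN cG]].
    have [hN hG] := fixed_spaceP _ _ _ (evP (h : H)).
    by split=> // s n _; apply: hG.
  have Uc : (c : grpalg _ _) \in fixed_space N lam.
    by apply/fixed_spaceP; split=> // s n Nn; apply: cG; rewrite ?mem_gal.
  by exists (mk_descended gal_lambda_norm Uc).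
- split=> [|h k]; first by apply/ffunP=> n; rewrite [LHS](ev1 gal_lambda_norm) ffunE.
  apply: grpalg_mul_conv.
    by have [] := fixed_spaceP _ _ _ (evP (h : H)).
  by have [] := fixed_spaceP _ _ _ (evP (k : H)).
- split=> [h n n'|h].
    rewrite [LHS](ev_dcomul (gal_lambdaM L) galLt dual trace_theta (h : H)).
    by case: eqP; rewrite ?mul1r ?mul0r.
  rewrite [LHS](dcounitE galLt (h : H)) [RHS]big_mkcond; apply: eq_bigr => n _.
  by case: ifPn => // /(ev_out (h : H)).
- by move=> h n; apply: ev_dantipode.
by move=> h x; rewrite [LHS]dactE act_valN.
Qed.

End Regular.

Lemma gp_exists (K : fieldType) (Lt : splittingFieldType K) (L : {subfield Lt})
    (N : {group {perm {set gal_of {:Lt}}}}) : galois 1 {:Lt} ->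
  regular_on (gal_cosets L) N -> normalized_by_gal L N ->
  exists A : hopfGalois (subvs_of L), gp_corresponds A N.
Proof.
move=> galLt regN nNG; have [r [d [e dual]]] := gal_dual Lt.
have [theta tr1] := trace_one Lt.
exists (gp_structure galLt regN nNG dual tr1); exact: gp_structure_corresponds.
Qed.

(** * Hopf Galois structures determine their regular subgroup *)

Section Uniqueness.

Variables (K : fieldType) (Lt : splittingFieldType K) (L : {subfield Lt}).
Hypothesis galLt : galois 1 {:Lt}.
Local Notation G' := ('Gal({:Lt} / L) : {set gal_of {:Lt}}).
Local Notation S := (gal_cosets L).
Local Notation lam := (gal_lambda L).
Local Notation permT := ({perm {set gal_of {:Lt}}}).
Implicit Types (A B : hopfGalois (subvs_of L)) (N : {group permT}) (n m : permT).

Lemma normalizedJ N n s : normalized_by_gal L N -> ((n ^ lam s)%g \in N) = (n \in N).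
Proof.
by move=> nN; rewrite memJ_norm // (subsetP nN) // imset_f // mem_gal.
Qed.

(** The case of [fixed_Lt_free] in which only the image of phi is known. *)
Lemma gp_Lt_free A N (phi : {linear A -> {ffun permT -> Lt}}) :
    normalized_by_gal L N -> injective phi ->
    (forall c, (exists h, phi h = c) <-> in_grpalg N c /\ gal_fixed L N c) ->
  Lt_free (fun h n => phi h n).
Proof.
move=> nN phi_inj phi_im; apply: (fixed_Lt_free galLt) => [n k h h'|h h0|s n].
- by rewrite linearP !ffunE.
- by apply: phi_inj; apply/ffunP=> n; rewrite h0 linear0 ffunE.
exists (n ^ lam s^-1)%g => h.
have [cN cG] : in_grpalg N (phi h) /\ gal_fixed L N (phi h).
  by apply/phi_im; exists h.
have [Nn|N'n] := boolP (n \in N).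
  rewrite -cG ?mem_gal ?(normalizedJ _ _ nN) //.
  by rewrite -conjgM -gal_lambdaM mulVg gal_lambda1 conjg1.
by rewrite !cN ?(normalizedJ _ _ nN) // rmorph0.
Qed.

(** Both algebras are identified with the same fixed elements of Lt[N], whose
    values determine all the operations. *)
Lemma gp_hg_iso A B N : normalized_by_gal L N ->
  gp_corresponds A N -> gp_corresponds B N -> hg_iso A B.
Proof.
move=> nN [phiA [[injA imA] [oneA mulA] [comA couA] antA actA]].
case=> phiB [[injB imB] [oneB mulB] [comB couB] antB actB].
have exf h : exists k, phiB k == phiA h.
  have [k <-] : exists k, phiB k = phiA h by apply/imB/imA; exists h.
  by exists k.
have exg k : exists h, phiA h == phiB k.
  have [h <-] : exists h, phiA h = phiB k by apply/imA/imB; exists k.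
  by exists h.
pose f h := xchoose (exf h); pose g k := xchoose (exg k).
have fE h : phiB (f h) = phiA h by apply/eqP/(xchooseP (exf h)).
have gE k : phiA (g k) = phiB k by apply/eqP/(xchooseP (exg k)).
have f_lin : linear f by move=> a h k; apply: injB; rewrite linearP !fE linearP.
have f_mul : monoid_morphism f.
  by split=> [|h k]; apply: injB; rewrite ?mulB !fE ?oneA ?oneB ?mulA.
pose M1 := GRing.isLinear.Build K A B _ f f_lin.
pose M2 := GRing.isMonoidMorphism.Build A B f f_mul.
pose F : {lrmorphism A -> B} := HB.pack f M1 M2.
have FE h : phiB (F h) = phiA h := fE h.
exists F; split.
- by exists g => h; [apply: injA; rewrite gE FE | apply: injB; rewrite FE gE].
- move=> h; have freeB := gp_Lt_free nN injB imB.
  have linB n : linear (fun k => phiB k n) by move=> a k k'; rewrite linearP !ffunE.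
  apply: (tlift_eval_inj freeB _ linB) => [k k0 | n n'].
    by apply: injB; apply/ffunP=> n; rewrite k0 linear0 ffunE.
  rewrite comB FE (tlift_morph _ _ (tlift_is_linear _)) -comA.
  apply: eq_tlift => a b; rewrite tlift_tens ?FE //.
    by move=> y c u v; rewrite linB mulrDl scalerAl.
  by move=> y c u v; rewrite linB mulrDr scalerAr.
- by move=> h; apply: (@alg_inj _ Lt); rewrite couA couB FE.
- by move=> h; apply: injB; apply/ffunP=> n; rewrite antB !FE antA.
move=> h; apply/lfunP=> x; apply: val_inj; rewrite /= actA actB.
by apply: eq_bigr => n _; rewrite FE.
Qed.

Lemma gp_transport A B N : hg_iso A B -> gp_corresponds B N -> gp_corresponds A N.
Proof.
case=> f [[g fK gK] fcom fcou fant fact] [phi [[inj im] [one mul] [com cou] ant act]].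
have lin : linear (phi \o f) by move=> a h k; rewrite /= !linearP.
pose M1 := GRing.isLinear.Build K A {ffun permT -> Lt} _ (phi \o f) lin.
pose psi : {linear A -> {ffun permT -> Lt}} := HB.pack (phi \o f) M1.
have psiE h : psi h = phi (f h) by [].
exists psi; split.
- split=> [h k /inj /(can_inj fK) // | c]; apply: (iff_trans _ (im c)).
  by split=> [[h <-]|[k <-]]; [exists (f h) | exists (g k); rewrite psiE gK].
- by split=> [|h k]; rewrite !psiE ?rmorph1 ?rmorphM ?mul.
- split=> [h n n'|h]; last by rewrite -fcou cou.
  rewrite psiE -com fcom (tlift_morph _ _ (tlift_is_linear _)).
  apply: eq_tlift => a b; rewrite tlift_tens // => y c u v.
    by rewrite linearP !ffunE mulrDl scalerAl.
  by rewrite linearP !ffunE mulrDr scalerAr.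
- by move=> h n; rewrite !psiE -fant ant.
by move=> h x; rewrite -fact act.
Qed.

(** The image of phi contains the orbit sums. *)
Lemma gp_span A N (phi : {linear A -> {ffun permT -> Lt}}) (c : permT -> Lt) :
    normalized_by_gal L N ->
    (forall c, (exists h, phi h = c) <-> in_grpalg N c /\ gal_fixed L N c) ->
    (forall h, \sum_(n in N) c n * phi h n = 0) ->
  forall n, n \in N -> c n = 0.
Proof.
move=> nN phi_im H m Nm; have [r [d [e dual]]] := gal_dual Lt.
pose f i := orbit_elt (gal_lambdaM L) (gal_lambda_norm nN) (e i) m.
have fphi i : \sum_(n in N) c n * ev (f i) n = 0.
  have [hN hG] := fixed_spaceP _ _ _ (evP (f i)).
  have [|h Eh] := (phi_im (vsval (f i : subvs_of (fixed_space N lam)))).2.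
    by split=> // s n _; apply: hG.
  by rewrite -[RHS](H h); apply: eq_bigr => n _; rewrite Eh.
transitivity (\sum_(n in N) c n * \sum_i d i * ev (f i) n).
  rewrite (bigD1 m) //= [X in _ + X]big1 => [|n /andP[Nn nm]]; rewrite orbit_span // Nm.
    by rewrite eqxx mulr1 addr0.
  by rewrite eq_sym (negPf nm) mulr0.
under eq_bigr do rewrite mulr_sumr.
rewrite exchange_big big1 // => i _ /=.
under eq_bigr do rewrite mulrCA.
by rewrite -mulr_sumr fphi mulr0.
Qed.

(** Dedekind identifies the coefficient at n with the one at beta n, the element
    of N' with the same coset. As the coefficients are otherwise independent by
    [gp_span], comparing products shows that beta is a morphism. Since n moves
    the coset of m to that of n^-1 * m, the permutations n and beta n agree. *)
Lemma gp_group_unique A N N' :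
    regular_on S N -> regular_on S N' ->
    normalized_by_gal L N -> normalized_by_gal L N' ->
  gp_corresponds A N -> gp_corresponds A N' -> N = N'.
Proof.
move=> regN regN' nN nN' [phi [[inj im] [_ mul] _ _ act]] [phi' [_ [_ mul'] _ _ act']].
have ex_beta n : exists n',
    (n \in N) ==> (n' \in N') && (emb_coset L n' == emb_coset L n).
  have [Nn|_] := boolP (n \in N); last by exists 1%g.
  have [n' Nn' En'] := emb_coset_surj regN' (mem_emb_coset regN Nn).
  by exists n'; rewrite Nn' En' eqxx.
pose beta n := xchoose (ex_beta n).
have betaP n : n \in N -> beta n \in N' /\ emb_coset L (beta n) = emb_coset L n.
  by move=> Nn; have /implyP/(_ Nn)/andP[? /eqP] := xchooseP (ex_beta n).
have beta_inj : {in N &, injective beta}.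
  move=> n m Nn Nm E; apply: (emb_coset_inj regN Nn Nm).
  by rewrite -(betaP n Nn).2 E (betaP m Nm).2.
have im_beta : beta @: N = N'.
  apply/eqP; rewrite eqEcard card_in_imset // (card_regular galLt regN).
  rewrite (card_regular galLt regN') leqnn andbT.
  by apply/subsetP=> _ /imsetP[n /betaP[Nbn _] ->].
have phiE h n : n \in N -> phi' h (beta n) = phi h n.
  move=> Nn; apply/eqP; rewrite eq_sym -subr_eq0; apply/eqP.
  apply: (embed_indep galLt regN (c := fun n => phi h n - phi' h (beta n))) Nn => x Lx.
  under eq_bigr do rewrite mulrBl.
  rewrite sumrB.
  have := act h (Subvs Lx); rewrite act' /= => E.
  apply/eqP; rewrite subr_eq0; apply/eqP; rewrite -[LHS]E -im_beta big_imset //=.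
  by apply: eq_bigr => m Nm; rewrite /embed -(betaP m Nm).2.
have betaM : {in N &, {morph beta : n m / (n * m)%g}}.
  move=> b a Nb Na; set m := (b * a)%g.
  have Nm : m \in N by rewrite groupM.
  (* the difference of the structure constants of N and N' at m *)
  pose C x y : Lt := (y * x == m)%g%:R - (beta y * beta x == beta m)%g%:R.
  have C0 h k : \sum_(x in N) (\sum_(y in N) C x y * phi k y) * phi h x = 0.
    transitivity (phi (h * k) m - phi' (h * k) (beta m)); last by rewrite phiE ?subrr.
    rewrite mul mul' !ffunE -im_beta big_imset //= -sumrB; apply: eq_bigr => x Nx.
    rewrite !big_mkcondr big_imset //= -sumrB mulr_suml; apply: eq_bigr => y Ny.
    rewrite !phiE // /C -mulrA (mulrC (phi k y)) mulrBl.
    by congr (_ - _); case: eqP; rewrite ?mul1r ?mul0r.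
  have Cab : C a b = 0.
    apply: (gp_span (c := C a) nN im) Nb => k.
    by apply: (gp_span (c := fun x => \sum_(y in N) C x y * phi k y) nN im) Na => h.
  move/eqP: Cab; rewrite /C eqxx subr_eq0.
  by case: ((_ * _)%g =P _) => [<- //| _]; rewrite oner_eq0.
have emb_cosetE n m : n (emb_coset L m) = emb_coset L (n^-1 * m)%g.
  by rewrite /emb_coset invMg invgK permM.
have NN' n : n \in N -> beta n = n.
  move=> Nn; apply/permP=> X.
  have [SX|S'X] := boolP (X \in S); last first.
    have [/subsetP sN _ _] := regN; have [/subsetP sN' _ _] := regN'.
    by rewrite (Sym_out (sN _ Nn) S'X) (Sym_out (sN' _ (betaP n Nn).1) S'X).
  have [m Nm <-] := emb_coset_surj regN SX.
  rewrite [RHS]emb_cosetE; have Nnm : (n^-1 * m)%g \in N by rewrite groupM ?groupV.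
  rewrite -(betaP m Nm).2 emb_cosetE -(betaP _ Nnm).2; congr (emb_coset L _).
  by apply: (mulgI (beta n)); rewrite -betaM // !mulKVg.
apply/val_inj; rewrite /= -im_beta -[LHS]imset_id.
by apply: eq_in_imset => n Nn; rewrite NN'.
Qed.

End Uniqueness.

(** * The count for degree p^2 *)

Local Open Scope group_scope.

Section GaloisImage.

Variables (K : fieldType) (Lt : splittingFieldType K) (L : {subfield Lt}).
Local Notation S := (gal_cosets L).

Definition gal_lambda_morphism :=
  @Morphism _ _ 'Gal({:Lt} / 1) (gal_lambda L) (in2W (@gal_lambdaM K Lt L)).
Definition gal_image := (gal_lambda_morphism @* 'Gal({:Lt} / 1))%G.

Lemma normalized_by_galE (N : {group {perm {set gal_of {:Lt}}}}) :
  normalized_by_gal L N <-> gal_image \subset 'N(N).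
Proof. by rewrite /normalized_by_gal /gal_image /= morphimEdom. Qed.

Lemma gal_image_Sym : gal_image \subset perm.Sym S.
Proof. by apply/subsetP=> _ /morphimP[s _ _ ->]; apply: gal_lambda_Sym. Qed.

Lemma gal_image_trans : [transitive gal_image, on S | 'P].
Proof.
apply/imsetP; exists ('Gal({:Lt} / L) : {set _}); first exact: base_coset.
apply/setP=> X; apply/idP/imsetP => [SX | [_ /morphimP[s _ _ ->] ->]].
  exists (gal_lambda L (repr X)); last exact: coset_repr.
  by rewrite /gal_image /= (mem_morphim gal_lambda_morphism) ?mem_gal.
rewrite /= /aperm Sym_stable ?gal_lambda_Sym //; exact: base_coset.
Qed.

Lemma gal_image_isog : galois 1 {:Lt} -> is_normal_closure L ->
  'Gal({:Lt} / 1) \isog gal_image.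
Proof.
move=> galLt closL; apply: (sub_isog (f := gal_lambda_morphism) (subxx _)).
by apply/injmP; apply: in2W; apply: gal_lambda_inj.
Qed.

End GaloisImage.

Theorem theorem9 (p : nat) (K : fieldType) (Lt : splittingFieldType K)
    (L : {subfield Lt}) (p_prime : prime p) (p_odd : odd p)
    (sepL : separable 1 L) (degL : \dim L = (p ^ 2)%N)
    (closL : is_normal_closure L) :
  ((exists A : hopfGalois (subvs_of L), hg_has_type (Zp_group (p ^ 2)) A) <->
   (exists2 m : nat, (m %| p * p.-1)%N &
      isog_cyclic_sdprod 'Gal({:Lt} / 1) (p ^ 2) m)) /\
  (forall m : nat, (m %| p * p.-1)%N ->
     isog_cyclic_sdprod 'Gal({:Lt} / 1) (p ^ 2) m ->
     hg_number (fun A : hopfGalois (subvs_of L) =>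
                  hg_has_type (Zp_group (p ^ 2)) A)
               (if (m == 1%N) || (m == p) then p else 1%N)).
Proof.
have galLt := normal_closure_galois sepL closL.
have cardS : #|gal_cosets L| = (p ^ 2)%N by rewrite card_cosets.
have p2_gt0 : (0 < p ^ 2)%N by rewrite expn_gt0 prime_gt0.
have isoG := gal_image_isog galLt closL.
have sGS := gal_image_Sym L; have trG := gal_image_trans L.
have isogZ (N : {group {perm {set gal_of {:Lt}}}}) :
    regular_on (gal_cosets L) N -> (N \isog Zp_group (p ^ 2)) = cyclic N.
  move=> regN; rewrite isog_sym isog_cyclic_card ?Zp_cyclic //= card_Zp //.
  by rewrite (regular_card regN (degree_neq0 p_prime cardS)) cardS eqxx andbT.
have regC m : isog_cyclic_sdprod 'Gal({:Lt} / 1) (p ^ 2) m ->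
    #|gal_image L| = (p ^ 2 * m)%N /\
    exists c, [/\ c \in gal_image L, <[c]> <| gal_image L
      & regular_on (gal_cosets L) <[c]>%G].
  move=> sdG.
  have := isog_cyclic_sdprod_isog (isog_symr isoG) sdG.
  case/(isog_cyclic_sdprodP p2_gt0)=> cardG [C [nCG cycC cardC]]; split=> //.
  have regC := normal_cyclic_regular p_prime cardS sGS trG nCG cycC cardC.
  case/cyclicP: cycC => c defC; have {}defC : C = <[c]>%G by apply: val_inj.
  rewrite {C cardC}defC in nCG regC *; exists c; split=> //.
  by rewrite -cycle_subG normal_sub.
split; first split.
- case=> A [N [regN nN _ isoN]].
  have cycN : cyclic N by rewrite -isogZ.
  have [c [Gc nCG regc]] := regular_cyclic_normal p_prime p_odd cardS sGS trG regN
    cycN ((normalized_by_galE L N).1 nN).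
  have [m m_dv sdG] := regular_normal_cyclic_sdprod p_prime cardS sGS trG Gc nCG regc.
  by exists m => //; apply: isog_cyclic_sdprod_isog isoG sdG.
- case=> m _ /regC[_ [c [Gc nCG regc]]].
  have nN : normalized_by_gal L <[c]>%G by apply/normalized_by_galE/normal_norm.
  have [A corA] := gp_exists galLt regc nN.
  by exists A, <[c]>%G; split=> //; rewrite isogZ ?cycle_cyclic.
move=> m _ /regC[cardG [c [Gc nCG regc]]].
have [F [F_inj F_good F_all]] :=
  count_regular_cyclic p_prime p_odd cardS sGS Gc nCG regc cardG.
have nF i : normalized_by_gal L (F i).
  by apply/normalized_by_galE; have [] := F_good i.
have regF i : regular_on (gal_cosets L) (F i) by have [] := F_good i.
have /fin_all_exists[A corA] i :
    exists A : hopfGalois (subvs_of L), gp_corresponds A (F i).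
  exact: gp_exists galLt (regF i) (nF i).
exists A; split=> [i | i j iso_ij | B [N [regN nN corB isoN]]].
- exists (F i); split; [exact: regF | exact: nF | exact: corA |].
  by rewrite isogZ //; case: (F_good i).
- apply: F_inj; have corj := gp_transport iso_ij (corA j).
  exact: (gp_group_unique galLt (regF i) (regF j) (nF i) (nF j) (corA i) corj).
have [|i defN] := F_all N.
  split; [exact: regN | by rewrite -isogZ | exact: (normalized_by_galE L N).1].
exists i; rewrite defN in corB.
exact: (gp_hg_iso galLt (nF i) corB (corA i)).
Qed.
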